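(* Let $\Sigma_{16}^+$ be the real half-spin representation of $\mathrm{Spin}(16)$. The fourth exterior power $\Lambda^4(\Sigma_{16}^+)$ has no trivial summand as a representation of $\mathrm{Spin}(16)$; equivalently, $(\Lambda^4\Sigma_{16}^+)^{\mathfrak{spin}(16)}=0$.
   Context: $\Sigma_{16}^+$ is the real irreducible half-spin representation of $\mathrm{Spin}(16)$, of real dimension $128$. Exterior powers are taken over $\mathbb{R}$. *)

(* Defs.v *)
From HB Require Import structures.
From mathcomp Require Import all_boot all_order all_algebra.
From mathcomp Require Import ring reals.

Set Implicit Arguments.
Unset Strict Implicit.
Unset Printing Implicit Defensive.

Import GRing.Theory.
Local Open Scope ring_scope.

(* The Clifford algebra of the diagonal quadratic form with values q i on an
   orthogonal basis e_0, ..., e_(n-1), in the convention v * v = q(v).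
   Coordinates are taken in the blade basis e_A = e_(a1) * ... * e_(ak) for
   A = {a1 < ... < ak}.  For q = 0 this is the exterior algebra. *)
Definition clifford (F : fieldType) (n : nat) (q : 'I_n -> F) :=
  {ffun {set 'I_n} -> F^o}.

HB.instance Definition _ (F : fieldType) (n : nat) (q : 'I_n -> F) :=
  Vector.copy (clifford q) {ffun {set 'I_n} -> F^o}.

Section CliffordAlgebra.
Variables (F : fieldType) (n : nat) (q : 'I_n -> F).
Implicit Types (A B C D : {set 'I_n}) (x y z : clifford q).

Definition symdiff A B : {set 'I_n} := (A :\: B) :|: (B :\: A).

Definition blade_sign A B : F :=
  \prod_(i in A) \prod_(j in B) (if (j < i)%N then -1 else 1).

(* e_A * e_B = blade_coef A B *: e_(symdiff A B): sort the generators, then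
   contract the repeated ones. *)
Definition blade_coef A B : F := blade_sign A B * \prod_(i in A :&: B) q i.

Definition blade A : clifford q := [ffun C => (C == A)%:R].

Definition cl_one : clifford q := blade set0.

Definition cl_mul x y : clifford q :=
  [ffun C => \sum_A (x A : F) * (y (symdiff A C) : F)
                    * blade_coef A (symdiff A C)].

Lemma in_symdiff A B i : (i \in symdiff A B) = (i \in A) (+) (i \in B).
Proof. by rewrite !inE; case: (i \in A); case: (i \in B). Qed.

Lemma symdiffA : associative symdiff.
Proof. by move=> A B C; apply/setP=> i; rewrite !in_symdiff addbA. Qed.

Lemma symdiffC : commutative symdiff.
Proof. by move=> A B; apply/setP=> i; rewrite !in_symdiff addbC. Qed.

Lemma symdiffK A : cancel (symdiff A) (symdiff A).
Proof.
by move=> B; apply/setP=> i; rewrite !in_symdiff addbA addbb.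
Qed.

Lemma symdiff0 A : symdiff A set0 = A.
Proof. by apply/setP=> i; rewrite in_symdiff inE addbF. Qed.

Lemma sym0diff A : symdiff set0 A = A.
Proof. by rewrite symdiffC symdiff0. Qed.

Lemma prod_symdiff (f : 'I_n -> F) A B : (forall i, f i * f i = 1) ->
  \prod_(i in symdiff A B) f i = (\prod_(i in A) f i) * \prod_(i in B) f i.
Proof.
move=> ff; rewrite big_mkcond [in RHS]big_mkcond [X in _ * X]big_mkcond -big_split.
apply: eq_bigr => i _ /=; rewrite in_symdiff.
by case: (i \in A); case: (i \in B); rewrite /= ?ff ?mul1r ?mulr1.
Qed.

Lemma blade_sign_symdiffl A B C :
  blade_sign (symdiff A B) C = blade_sign A C * blade_sign B C.
Proof.
apply: prod_symdiff => i; rewrite -big_split big1 // => j _ /=.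
by case: ifP; rewrite ?mulrNN mulr1.
Qed.

Lemma blade_sign_symdiffr A B C :
  blade_sign A (symdiff B C) = blade_sign A B * blade_sign A C.
Proof.
rewrite -big_split; apply: eq_bigr => i _; apply: prod_symdiff => j.
by case: ifP; rewrite ?mulrNN mulr1.
Qed.

Lemma blade_coefA A B C :
  blade_coef A B * blade_coef (symdiff A B) C =
  blade_coef B C * blade_coef A (symdiff B C).
Proof.
rewrite /blade_coef blade_sign_symdiffl blade_sign_symdiffr.
have -> : blade_sign A B * \prod_(i in A :&: B) q i *
    (blade_sign A C * blade_sign B C * \prod_(i in symdiff A B :&: C) q i) =
  blade_sign A B * blade_sign A C * blade_sign B C *
    (\prod_(i in A :&: B) q i * \prod_(i in symdiff A B :&: C) q i) by ring.
have -> : \prod_(i in A :&: B) q i * \prod_(i in symdiff A B :&: C) q i =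
          \prod_(i in B :&: C) q i * \prod_(i in A :&: symdiff B C) q i.
  rewrite big_mkcond [X in _ * X]big_mkcond [in RHS]big_mkcond.
  rewrite [X in _ = _ * X]big_mkcond -!big_split.
  apply: eq_bigr => i _ /=; rewrite !(in_setI, in_symdiff).
  by case: (i \in A); case: (i \in B); case: (i \in C);
     rewrite /= ?mul1r ?mulr1.
by ring.
Qed.

Lemma blade_coef0l A : blade_coef set0 A = 1.
Proof. by rewrite /blade_coef /blade_sign set0I !big_set0 mulr1. Qed.

Lemma blade_coef0r A : blade_coef A set0 = 1.
Proof.
rewrite /blade_coef /blade_sign setI0 big_set0 mulr1 big1 // => i _.
by rewrite big_set0.
Qed.

Fact cl_mulA : associative cl_mul.
Proof.
move=> x y z; apply/ffunP=> D; rewrite !ffunE.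
transitivity (\sum_A \sum_C (x A : F) * (y (symdiff A C) : F) *
    (z (symdiff C D) : F) *
    (blade_coef A (symdiff A C) * blade_coef C (symdiff C D))); last first.
  rewrite exchange_big; apply: eq_bigr => C _ /=.
  by rewrite ffunE !mulr_suml; apply: eq_bigr => A _; ring.
apply: eq_bigr => A _; rewrite ffunE mulr_sumr mulr_suml.
rewrite (reindex_inj (can_inj (symdiffK A))); apply: eq_bigr => C _ /=.
have -> : symdiff (symdiff A C) (symdiff A D) = symdiff C D.
  by rewrite (symdiffC A C) -symdiffA symdiffK.
have := blade_coefA A (symdiff A C) (symdiff C D).
rewrite symdiffK -symdiffA symdiffK => e.
by rewrite -[RHS]mulrA -/(blade_coef _ _) e; ring.
Qed.

Fact cl_mul1 : left_id cl_one cl_mul.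
Proof.
move=> x; apply/ffunP=> D; rewrite ffunE (bigD1 set0) //= big1 => [|A /negPf nA].
  by rewrite ffunE eqxx sym0diff blade_coef0l mul1r mulr1 addr0.
by rewrite ffunE nA !mul0r.
Qed.

Fact cl_mulr1 : right_id cl_one cl_mul.
Proof.
move=> x; apply/ffunP=> D; rewrite ffunE (bigD1 D) //= big1 => [|A nA].
  have -> : symdiff D D = set0 by rewrite -{2}[D]symdiff0 symdiffK.
  by rewrite ffunE eqxx blade_coef0r !mulr1 addr0.
rewrite ffunE; case: eqP => [e|_]; last by rewrite mulr0 mul0r.
by case/eqP: nA; rewrite -[RHS](symdiffK A) e symdiff0.
Qed.

Fact cl_mulDl : left_distributive cl_mul +%R.
Proof.
move=> x y z; apply/ffunP=> D; rewrite !ffunE -big_split.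
by apply: eq_bigr => A _; rewrite ffunE /=; ring.
Qed.

Fact cl_mulDr : right_distributive cl_mul +%R.
Proof.
move=> x y z; apply/ffunP=> D; rewrite !ffunE -big_split.
by apply: eq_bigr => A _; rewrite ffunE /=; ring.
Qed.

Fact cl_one_neq0 : cl_one != 0.
Proof. by apply/eqP=> /ffunP /(_ set0) /eqP; rewrite !ffunE eqxx oner_eq0. Qed.

HB.instance Definition _ := GRing.Zmodule_isNzRing.Build (clifford q)
  cl_mulA cl_mul1 cl_mulr1 cl_mulDl cl_mulDr cl_one_neq0.

Fact cl_scaleAl (a : F) x y : a *: (x * y) = (a *: x) * y.
Proof.
apply/ffunP=> D; rewrite !ffunE scaler_sumr.
by apply: eq_bigr => A _; rewrite !ffunE /GRing.scale /=; ring.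
Qed.

HB.instance Definition _ :=
  GRing.Lmodule_isLalgebra.Build F (clifford q) cl_scaleAl.

Fact cl_scaleAr (a : F) x y : a *: (x * y) = x * (a *: y).
Proof.
apply/ffunP=> D; rewrite !ffunE scaler_sumr.
by apply: eq_bigr => A _; rewrite !ffunE /GRing.scale /=; ring.
Qed.

HB.instance Definition _ :=
  GRing.Lalgebra_isAlgebra.Build F (clifford q) cl_scaleAr.

Definition cl_vec (v : 'rV[F]_n) : clifford q :=
  \sum_i v 0 i *: blade [set i].

Lemma blade_mul A B :
  blade A * blade B = blade_coef A B *: blade (symdiff A B).
Proof.
apply/ffunP=> D; rewrite !ffunE (bigD1 A) //= big1 => [|C /negPf nC].
  rewrite !ffunE eqxx mul1r addr0 /GRing.scale /=.
  have -> : (symdiff A D == B) = (D == symdiff A B).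
    by apply/eqP/eqP=> [<-|->]; rewrite symdiffK.
  by case: eqP => [->|_]; rewrite ?symdiffK ?mul1r ?mulr1 // mul0r mulr0.
by rewrite ffunE nC !mul0r.
Qed.

Lemma cl_basis x : x = \sum_A (x A : F) *: blade A.
Proof.
apply/ffunP=> D; rewrite sum_ffunE (bigD1 D) //= big1 => [|A nA].
  by rewrite !ffunE eqxx addr0 /GRing.scale /= mulr1.
by rewrite !ffunE eq_sym (negPf nA) scaler0.
Qed.

Lemma symdiffxx A : symdiff A A = set0.
Proof. by rewrite -{2}[A]symdiff0 symdiffK. Qed.

Lemma gen_sqr i : blade [set i] * blade [set i] = (q i)%:A.
Proof.
by rewrite blade_mul symdiffxx /blade_coef /blade_sign setIid !big_set1 ltnn mul1r.
Qed.

Lemma gen_anticomm i j : i != j ->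
  blade [set i] * blade [set j] = - (blade [set j] * blade [set i]).
Proof.
move=> nij; rewrite !blade_mul symdiffC -scaleNr; congr (_ *: _).
have d (k l : 'I_n) : k != l -> [set k] :&: [set l] = set0 :> {set 'I_n}.
  by move=> nkl; apply/setP=> m; rewrite !inE; case: eqP => // ->;
     rewrite (negPf nkl).
rewrite /blade_coef /blade_sign !d ?(eq_sym j) // !big_set0 !mulr1 !big_set1.
by case: ltngtP nij => [||/val_inj->]; rewrite ?opprK ?eqxx.
Qed.

Lemma enum_sorted (s : seq 'I_n) :
  sorted ltn (map val s) -> enum [set i in s] = s.
Proof.
move=> ss; apply: (inj_map val_inj).
apply: (irr_sorted_eq ltn_trans ltnn) => //.
  apply: (subseq_sorted ltn_trans (s2 := map val (enum 'I_n))).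
    by apply: map_subseq; rewrite !enumT {1}/enum_mem filter_subseq.
  by rewrite val_enum_ord iota_ltn_sorted.
by apply: eq_mem_map => i; rewrite mem_enum inE.
Qed.

Lemma sorted_enum A : sorted ltn (map val (enum A)).
Proof.
apply: (subseq_sorted ltn_trans (s2 := map val (enum 'I_n))).
  by apply: map_subseq; rewrite !enumT {1}/enum_mem filter_subseq.
by rewrite val_enum_ord iota_ltn_sorted.
Qed.

Lemma blade_prod A : blade A = \prod_(i <- enum A) blade [set i].
Proof.
have H (s : seq 'I_n) : sorted ltn (map val s) ->
    \prod_(i <- s) blade [set i] = blade [set i in s].
  elim: s => [|i s IH] /= ps.
    by rewrite big_nil /GRing.one /= /cl_one; congr blade; apply/setP=> i; rewrite !inE.
  rewrite big_cons IH ?(path_sorted ps) // blade_mul.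
  move: ps; rewrite path_sortedE; last exact: ltn_trans.
  case/andP=> /allP lt_is _.
  have lt_i j : j \in s -> (i < j)%N by move=> js; apply/lt_is/map_f.
  have nis : i \notin s by apply/negP=> /lt_i; rewrite ltnn.
  have e : symdiff [set i] [set j in s] = [set j in i :: s].
    apply/setP=> j; rewrite in_symdiff !inE.
    by case: eqP => // ->; rewrite (negPf nis).
  rewrite e /blade_coef /blade_sign big_set1 big1 => [|j]; last first.
    by rewrite inE => /lt_i lij; rewrite ltnNge ltnW.
  rewrite mul1r big1 ?scale1r // => j; rewrite !inE => /andP[/eqP->].
  by rewrite (negPf nis).
rewrite H ?sorted_enum //; congr blade.
by apply/setP=> i; rewrite inE mem_enum.
Qed.

Section Universal.
Variables (T : algType F) (phi : 'I_n -> T).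
Hypothesis phi_sqr : forall i, phi i * phi i = (q i)%:A.
Hypothesis phi_anticomm : forall i j, i != j -> phi i * phi j = - (phi j * phi i).

Let P A := \prod_(i <- enum A) phi i.

Definition cl_lift x : T := \sum_A (x A : F) *: P A.

Lemma cl_lift_linear : linear cl_lift.
Proof.
move=> a x y; rewrite /cl_lift scaler_sumr -big_split.
by apply: eq_bigr => A _; rewrite !ffunE scalerDl scalerA.
Qed.
HB.instance Definition _ := GRing.isSemilinear.Build F (clifford q) T _ cl_lift
  (GRing.semilinear_linear cl_lift_linear).

Lemma cl_lift_blade A : cl_lift (blade A) = P A.
Proof.
rewrite /cl_lift (bigD1 A) //= big1 => [|B /negPf nB].
  by rewrite ffunE eqxx scale1r addr0.
by rewrite ffunE nB scale0r.
Qed.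

Lemma P_ge (i : 'I_n) A : (forall j, j \in A -> (i < j)%N) -> P (i |: A) = phi i * P A.
Proof.
move=> lt_i; rewrite /P.
have -> : i |: A = [set j in i :: enum A].
  by apply/setP=> j; rewrite !inE mem_enum.
rewrite enum_sorted ?big_cons //= path_sortedE; last exact: ltn_trans.
rewrite sorted_enum andbT; apply/allP=> k /mapP[j]; rewrite mem_enum => /lt_i lj ->.
exact: lj.
Qed.

Lemma mul_phi_P (i : 'I_n) A :
  phi i * P A = blade_coef [set i] A *: P (symdiff [set i] A).
Proof.
have H (s : seq 'I_n) : sorted ltn (map val s) ->
    phi i * P [set j in s] =
    blade_coef [set i] [set j in s] *: P (symdiff [set i] [set j in s]).
  elim: s => [|j s IH] /= ps.
    have -> : [set j in [::]] = set0 :> {set 'I_n} by apply/setP=> k; rewrite !inE.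
    rewrite symdiff0 blade_coef0r scale1r -[[set i]]setU0 P_ge // => k.
    by rewrite inE.
  have ss := path_sorted ps.
  move: ps; rewrite path_sortedE; last exact: ltn_trans.
  case/andP=> /allP lt_js _.
  have lt_j k : k \in [set k in s] -> (j < k)%N.
    by rewrite inE => ks; apply/lt_js/map_f.
  have njs : j \notin [set k in s] by apply/negP=> /lt_j; rewrite ltnn.
  have -> : [set k in j :: s] = j |: [set k in s].
    by apply/setP=> k; rewrite !inE.
  set B := [set k in s] in lt_j njs IH *.
  have coefU : i != j -> blade_coef [set i] (j |: B) =
      (if (j < i)%N then -1 else 1) * blade_coef [set i] B.
    move=> nij; rewrite /blade_coef /blade_sign !big_set1 big_setU1 //= -mulrA.
    congr (_ * (_ * _)); apply: eq_bigl => k; rewrite !inE.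
    by case: (k =P i) => // ->; rewrite (negPf nij).
  have [e|nij] := eqVneq i j.
    subst j; rewrite P_ge // mulrA phi_sqr.
    have -> : symdiff [set i] (i |: B) = B.
      apply/setP=> k; rewrite in_symdiff !in_setU !in_set1.
      by case: (k =P i) => //= ->; rewrite (negPf njs).
    rewrite -scalerAl mul1r; congr (_ *: _).
    rewrite /blade_coef /blade_sign !big_set1 big_setU1 //= ltnn mul1r big1.
      rewrite mul1r (_ : _ :&: _ = [set i]) ?big_set1 //.
      by apply/setP=> k; rewrite !inE; case: (k =P i).
    by move=> k /lt_j lik; rewrite ltnNge ltnW.
  have [lji|lij|/val_inj e] := ltngtP j i; last by rewrite e eqxx in nij.
    rewrite P_ge // mulrA phi_anticomm // mulNr -mulrA IH // coefU // lji.
    rewrite mulN1r scaleNr; congr (- _); rewrite -scalerAr; congr (_ *: _).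
    rewrite -P_ge => [|k]; last first.
      by rewrite in_symdiff in_set1; case: (k =P i) => [-> //|_ /lt_j].
    congr P; apply/setP=> k; rewrite !(in_symdiff, in_setU, in_set1).
    by case: (k =P j) => [->|_] //=; rewrite eq_sym (negPf nij).
  have lt_i k : k \in j |: B -> (i < k)%N.
    by rewrite in_setU1 => /orP[/eqP->//|/lt_j]; apply: ltn_trans.
  have ni : i \notin j |: B by apply/negP=> /lt_i; rewrite ltnn.
  have -> : symdiff [set i] (j |: B) = i |: (j |: B).
    apply/setP=> k; rewrite in_symdiff [RHS]in_setU1 in_set1.
    by case: (k =P i) => //= ->; rewrite (negPf ni).
  rewrite (P_ge lt_i) /blade_coef /blade_sign big_set1 big1 => [|k /lt_i lik].
    rewrite mul1r big1 ?scale1r // => k.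
    by rewrite in_setI in_set1 => /andP[/eqP->]; rewrite (negPf ni).
  by rewrite ltnNge ltnW.
have -> : A = [set j in enum A] by apply/setP=> j; rewrite inE mem_enum.
exact/H/sorted_enum.
Qed.

Lemma cl_liftM x y : cl_lift (x * y) = cl_lift x * cl_lift y.
Proof.
have lift1 i z : cl_lift (blade [set i] * z) = phi i * cl_lift z.
  rewrite [z]cl_basis mulr_sumr !linear_sum mulr_sumr; apply: eq_bigr => A _.
  rewrite -scalerAr !linearZ -scalerAr; congr (_ *: _).
  by rewrite blade_mul linearZ /= !cl_lift_blade mul_phi_P.
have lifts (s : seq 'I_n) z : cl_lift (\prod_(i <- s) blade [set i] * z) =
    \prod_(i <- s) phi i * cl_lift z.
  elim: s => [|i s IH]; first by rewrite !big_nil !mul1r.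
  by rewrite !big_cons -!mulrA lift1 IH.
rewrite [x]cl_basis mulr_suml !linear_sum mulr_suml; apply: eq_bigr => A _.
by rewrite -scalerAl !linearZ -scalerAl /= blade_prod lifts -blade_prod cl_lift_blade.
Qed.

End Universal.
Lemma cl_vec_volume (v : 'rV[F]_n) : ~~ odd n ->
  cl_vec v * \prod_(i < n) blade [set i] =
  - (\prod_(i < n) blade [set i] * cl_vec v).
Proof.
move=> n_even.
have anti i (s : seq 'I_n) : i \notin s ->
    blade [set i] * \prod_(j <- s) blade [set j] =
    (-1) ^+ size s *: (\prod_(j <- s) blade [set j] * blade [set i]).
  elim: s => [|j s IH] /=; first by rewrite big_nil mul1r mulr1 scale1r.
  rewrite inE negb_or => /andP[nij nis]; rewrite !big_cons mulrA gen_anticomm //.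
  rewrite mulNr -!mulrA IH // -scalerAr -scaleNr.
  by rewrite exprS mulN1r.
rewrite mulr_suml mulr_sumr -sumrN; apply: eq_bigr => i _.
rewrite -scalerAl -scalerAr -scalerN; congr (_ *: _).
have [s1 [s2 [e n1 n2]]] : exists s1 s2, [/\ index_enum 'I_n = s1 ++ i :: s2,
    i \notin s1 & i \notin s2].
  have := index_enum_uniq 'I_n; case/splitPr: (mem_index_enum i) => s1 s2.
  rewrite cat_uniq /= !negb_or => /and4P[_ /andP[n1 _] n2 _].
  by exists s1, s2.
have odd12 : odd (size s1 + size s2).
  have := congr1 size e; rewrite /index_enum -enumT size_enum_ord size_cat /= => en.
  by move: n_even; rewrite (congr1 odd en) addnS /= negbK.
rewrite e big_cat big_cons /=.
set X := \prod_(j <- s1) _; set Y := \prod_(j <- s2) _; set b := blade _.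
have eX : b * X = (-1) ^+ size s1 *: (X * b) by apply: anti.
have eY : Y * b = (-1) ^+ size s2 *: (b * Y).
  by rewrite anti // scalerA -expr2 sqrr_sign scale1r.
rewrite !mulrA eX -!scalerAl -!mulrA eY -!scalerAr -scaleNr; congr (_ *: _).
rewrite -(signr_odd _ (size s1)) -(signr_odd _ (size s2)).
by move: odd12; rewrite oddD; case: (odd (size s1)); case: (odd (size s2));
   rewrite // ?opprK.
Qed.

End CliffordAlgebra.

(* Cl_n: the Clifford algebra of R^n with v * v = - |v|^2. *)
Notation Cl R n := (@clifford R n (fun _ => -1)).

Section Spin.
Variables (R : realType) (n : nat).

Definition unit_vector (v : 'rV[R]_n) : Prop := \sum_i v 0 i ^+ 2 = 1.

Definition Spin (g : Cl R n) : Prop :=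
  exists s : seq 'rV[R]_n,
    [/\ ~~ odd (size s), forall v, v \in s -> unit_vector v &
        g = \prod_(v <- s) cl_vec _ v].

(* The Lie algebra of Spin(n), with bracket the commutator of Cl_n. *)
Definition spin_lie : {vspace Cl R n} :=
  (\sum_(i < n) \sum_(j < n | (i < j)%N)
     <[blade _ [set i] * blade _ [set j]]>)%VS.

Definition volume : Cl R n := \prod_(i < n) blade _ [set i].

Let cl_vec_vol (n_even : ~~ odd n) v :
  cl_vec _ v * volume = - (volume * cl_vec _ v).
Proof. exact: cl_vec_volume. Qed.

Lemma Spin_volume g : ~~ odd n -> Spin g -> g * volume = volume * g.
Proof.
move=> n_even [s [s_even _ ->]].
have H (t : seq 'rV[R]_n) : \prod_(v <- t) cl_vec _ v * volume =
    (-1) ^+ size t *: (volume * \prod_(v <- t) cl_vec _ v).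
  elim: t => [|v t IH]; first by rewrite big_nil mul1r mulr1 scale1r.
  rewrite !big_cons -mulrA IH -scalerAr !mulrA cl_vec_vol // mulNr.
  by rewrite exprS mulN1r scaleNr scalerN.
by rewrite H -signr_odd (negPf s_even) scale1r.
Qed.

Lemma cl_vec_delta i : cl_vec _ (delta_mx 0 i) = blade _ [set i] :> Cl R n.
Proof.
rewrite /cl_vec (bigD1 i) //= big1 => [|j nj].
  by rewrite mxE !eqxx scale1r addr0.
by rewrite mxE (negPf nj) andbF scale0r.
Qed.

Lemma spin_lie_volume g : ~~ odd n -> g \in spin_lie -> g * volume = volume * g.
Proof.
move=> n_even /memv_sumP[a /(_ _ isT) aP ->].
rewrite mulr_suml mulr_sumr; apply: eq_bigr => i _.
have /memv_sumP[b bP ->] := aP i.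
rewrite mulr_suml mulr_sumr; apply: eq_bigr => j ij.
have /vlineP[k ->] := bP j ij.
rewrite -scalerAl -scalerAr; congr (_ *: _); rewrite -!cl_vec_delta.
by rewrite -mulrA cl_vec_vol // mulrN mulrA cl_vec_vol // mulNr opprK mulrA.
Qed.

End Spin.

Section HalfSpin.
Variables (R : realType) (n N : nat).
Variable rho : {lrmorphism Cl R n -> 'M[R]_N.+1}.

Definition irreducible_module : Prop :=
  forall U : {vspace 'cV[R]_N.+1},
    (forall x u, u \in U -> rho x *m u \in U) -> U = 0%VS \/ U = fullv.

(* S^+ for n divisible by 4, where volume ^+ 2 = 1. *)
Definition half_spin : {vspace 'cV[R]_N.+1} :=
  fixedSpace (linfun (mulmx (rho (volume R n)))).

(* The restriction of rho g to S^+, for g commuting with the volume element: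
   the projection vsproj is then applied to a vector of S^+. *)
Definition half_spin_rep (g : Cl R n) : 'End(subvs_of half_spin) :=
  (linfun (vsproj half_spin) \o linfun (mulmx (rho g)) \o linfun vsval)%VF.

Lemma half_spin_repE (g : Cl R n) (u : subvs_of half_spin) :
  g * volume R n = volume R n * g ->
  vsval (half_spin_rep g u) = rho g *m vsval u.
Proof.
move=> gw; rewrite /half_spin_rep !comp_lfunE !lfunE /= vsprojK //.
have /fixedSpaceP := subvsP u; rewrite lfunE /= => uw.
apply/fixedSpaceP; rewrite lfunE /= mulmxA.
by have := congr1 rho gw; rewrite !rmorphM /= => /esym e;
   rewrite [_ *m rho g]e -mulmxA uw.
Qed.

End HalfSpin.

Section Exterior.
Variables (F : fieldType) (V : vectType F).

(* The exterior algebra of V, on the basis vbasis {:V}. *)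
Definition ext_alg := @clifford F (\dim {:V}) (fun _ => 0).
HB.instance Definition _ := GRing.Algebra.on ext_alg.
HB.instance Definition _ := Vector.on ext_alg.

Definition ext_basis (i : 'I_(\dim {:V})) : V := (vbasis {:V})`_i.

Definition ext_vec (v : V) : ext_alg :=
  \sum_i coord (vbasis {:V}) i v *: blade _ [set i].

Definition ext_power (k : nat) : {vspace ext_alg} :=
  (\sum_(A : {set 'I_(\dim {:V})} | #|A| == k) <[blade _ A : ext_alg]>)%VS.

Definition ext_map (f : 'End(V)) (x : ext_alg) : ext_alg :=
  \sum_(A : {set 'I_(\dim {:V})})
    (x A : F) *: \prod_(i <- enum A) ext_vec (f (ext_basis i)).

(* The derivation of the exterior algebra extending f. *)
Definition ext_der (f : 'End(V)) (x : ext_alg) : ext_alg :=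
  \sum_(A : {set 'I_(\dim {:V})})
    (x A : F) *: \sum_(j in A) \prod_(i <- enum A)
       ext_vec (if i == j then f (ext_basis i) else ext_basis i).

Lemma ext_vec_linear : linear ext_vec.
Proof.
move=> a u v; rewrite /ext_vec scaler_sumr -big_split.
by apply: eq_bigr => i _; rewrite linearP scalerDl scalerA.
Qed.
HB.instance Definition _ := GRing.isSemilinear.Build F V ext_alg _ ext_vec
  (GRing.semilinear_linear ext_vec_linear).

Let gen (i : 'I_(\dim {:V})) : ext_alg := blade _ [set i].

Let gen0 i : gen i * gen i = 0.
Proof. by rewrite /gen [LHS]gen_sqr scale0r. Qed.

Let genC i j : gen i * gen j = - (gen j * gen i).
Proof.
have [->|nij] := eqVneq i j; first by rewrite gen0 oppr0.
exact: gen_anticomm.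
Qed.

Lemma ext_vec_anticomm v w : ext_vec v * ext_vec w = - (ext_vec w * ext_vec v).
Proof.
rewrite /ext_vec mulr_suml mulr_sumr -sumrN; apply: eq_bigr => i _.
rewrite mulr_suml mulr_sumr -sumrN; apply: eq_bigr => j _.
rewrite -!scalerAl -!scalerAr !scalerA mulrC -scalerN; congr (_ *: _).
exact: genC.
Qed.

Lemma ext_vec_sqr v : ext_vec v * ext_vec v = 0.
Proof.
rewrite /ext_vec; elim: (index_enum _) => [|i s IH]; first by rewrite big_nil mul0r.
rewrite big_cons mulrDl !mulrDr IH addr0 -!scalerAl -!scalerAr -/(gen i) gen0.
rewrite !scaler0 add0r mulr_sumr mulr_suml !scaler_sumr -big_split big1 // => j _ /=.
rewrite -!scalerAl -!scalerAr !scalerA. rewrite -scalerDr.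
by rewrite -/(gen j) genC addNr scaler0.
Qed.

Lemma ext_vec_basis i : ext_vec (ext_basis i) = blade _ [set i].
Proof.
rewrite /ext_vec (bigD1 i) //= big1 => [|j nj].
  by rewrite coord_free ?eqxx ?scale1r ?addr0 // (basis_free (vbasisP _)).
by rewrite coord_free ?(basis_free (vbasisP _)) // eq_sym (negPf nj) scale0r.
Qed.

Lemma ext_map_prod (f : 'End(V)) (s : seq V) :
  ext_map f (\prod_(v <- s) ext_vec v) = \prod_(v <- s) ext_vec (f v).
Proof.
pose phi (i : 'I_(\dim {:V})) := ext_vec (f (ext_basis i)).
have phi0 i : phi i * phi i = 0%:A by rewrite ext_vec_sqr scale0r.
have phiC i j : i != j -> phi i * phi j = - (phi j * phi i).
  by move=> _; apply: ext_vec_anticomm.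
have mapE x : ext_map f x = cl_lift (q := fun=> 0) phi x by [].
have map1 v : ext_map f (ext_vec v) = ext_vec (f v).
  rewrite {2}(coord_vbasis (memvf v)) mapE !linear_sum.
  apply: eq_bigr => i _; rewrite !linearZ /=; congr (_ *: _).
  by rewrite cl_lift_blade enum_set1 big_seq1.
elim: s => [|v s IH].
  rewrite !big_nil mapE -[LHS]/(cl_lift phi (blade (fun=> 0) set0)) cl_lift_blade.
  by rewrite enum_set0 big_nil.
by rewrite !big_cons -IH -map1 !mapE; apply: cl_liftM.
Qed.

End Exterior.

Definition trivial_summand (F : fieldType) (E : vectType F) (G : Type)
    (P : G -> Prop) (act : G -> E -> E) (L : {vspace E}) : Prop :=
  exists T W : {vspace E},
    [/\ T != 0%VS, (T + W)%VS = L, (T :&: W)%VS = 0%VS,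
        forall g x, P g -> x \in T -> act g x = x &
        forall g x, P g -> x \in W -> act g x \in W].

(* Main.v *)
(* Let [S] be the half-spin module, [M_A] the action on [S] of the blade [e_A]
   for [A] of even size, and [J] an invariant scalar product.  The matrices [M_A]
   span [End S] and satisfy the Fierz identity
     sum_A (J M_A)_ij (J M_A)_kl = c J_ik J_jl,
   because their commutant is reduced to the scalars.  For an invariant [t] in
   Lambda^4 S put G(A, B) = sum t_ijkl (J M_A)_ij (J M_B)_kl.  Invariance under
   the elements (1 + e_i e_j) / sqrt 2 of the spin group forces G(A, B) = 0 unless
   [B] is [A] or its complement, and makes g(A) = G(A, A) depend on the size of
   [A] only.  As [t] is alternating, g(A) = 0 when [J M_A] is symmetric, that is
   when 4 divides |A|; what remains is alpha = g for |A| in {2, 14} and beta = g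
   for |A| in {6, 10}.  Exchanging the indices j and k with the Fierz identity,
   twisted by a blade [e_B], gives sum_A (-1)^|A :&: B| g(A) = - c g(B), which is 0
   for |B| in {0, 4}: two independent linear equations, 24 alpha = 88 beta and
   'C(16, 2) alpha + 'C(16, 6) beta = 0.  Hence G = 0 and t = 0. *)
From HB Require Import structures.
Require Import Defs.
From mathcomp Require Import all_boot all_order all_algebra.
From mathcomp Require Import ring lra reals.

Set Implicit Arguments.
Unset Strict Implicit.
Unset Printing Implicit Defensive.

Import Order.TTheory GRing.Theory Num.Theory.
Local Open Scope ring_scope.

(** * Signs of blade products *)

Section BladeSigns.
Variables (F : fieldType) (n : nat).
Implicit Types A B C : {set 'I_n}.

Local Notation bcoef := (@blade_coef F n (fun=> -1)).
Local Notation bsign := (@blade_sign F n).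

Lemma bladeN1_coefE A B : bcoef A B = bsign A B * (-1) ^+ #|A :&: B|.
Proof. by rewrite /blade_coef prodr_const. Qed.

Lemma blade_sign_sqr A B : bsign A B * bsign A B = 1.
Proof.
rewrite -big_split big1 // => i _; rewrite -big_split big1 // => j _ /=.
by case: ifP; rewrite ?mulrNN mulr1.
Qed.

Lemma bladeN1_coef_sqr A B : bcoef A B * bcoef A B = 1.
Proof. by rewrite bladeN1_coefE mulrACA blade_sign_sqr -expr2 sqrr_sign mulr1. Qed.

(** For [i != j] exactly one of the two products contributes -1, and for [i = j] neither does, so
    the exponent is |A||B| - |A :&: B| up to parity. *)
Lemma blade_sign_comm A B :
  bsign A B * bsign B A = (-1) ^+ (#|A| * #|B| + #|A :&: B|).
Proof.
have -> : bsign A B * bsign B A =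
    \prod_(i in A) \prod_(j in B) (if i == j then 1 else -1).
  rewrite /blade_sign [X in _ * X]exchange_big -big_split; apply: eq_bigr => i _.
  rewrite -big_split; apply: eq_bigr => j _ /=; rewrite -(inj_eq val_inj) /=.
  by case: ltngtP => _; rewrite ?mulr1 ?mul1r.
have -> : \prod_(i in A) \prod_(j in B) (if i == j then 1 else -1) =
    \prod_(i in A) ((-1) ^+ #|B| * (if i \in B then -1 else 1)) :> F.
  apply: eq_bigr => i _; rewrite -prodr_const; case: ifP => iB.
    rewrite (bigD1 i) //= eqxx mul1r [in RHS](bigD1 i) //= mulN1r mulNr mulrN1 opprK.
    by apply: eq_bigr => j /andP[_ /negPf]; rewrite eq_sym => ->.
  rewrite mulr1; apply: eq_bigr => j jB; case: eqP => // e.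
  by rewrite -e iB in jB.
rewrite big_split /= prodr_const -exprM mulnC exprD; congr (_ * _).
rewrite -prodr_const big_mkcond [RHS]big_mkcond; apply: eq_bigr => i _ /=.
by rewrite inE; case: (i \in A); case: (i \in B).
Qed.

Lemma bladeN1_coefC A B :
  bcoef A B = (-1) ^+ (#|A| * #|B| + #|A :&: B|) * bcoef B A.
Proof.
rewrite !bladeN1_coefE -blade_sign_comm [B :&: A]setIC mulrA; congr (_ * _).
by rewrite -mulrA blade_sign_sqr mulr1.
Qed.

(** Sorting e_A e_A costs one sign per pair in [A], contracting it one per element. For even |A| the
    result is 1 exactly when 4 divides |A|. *)
Lemma bladeN1_coef_diag A : bcoef A A = (-1) ^+ 'C(#|A|.+1, 2).
Proof.
rewrite bladeN1_coefE setIid binS exprD bin1; congr (_ * _).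
have [m] := ubnP #|A|; elim: m A => // m IH A.
have [->|[i iA]] := set_0Vmem A; first by rewrite cards0 /blade_sign big_set0.
rewrite (cardsD1 i) iA add1n ltnS => Am; have := IH _ Am; set B := A :\ i.
have niB : i \notin B by rewrite !inE eqxx.
have -> : A = symdiff B [set i].
  apply/setP=> j; rewrite in_symdiff !inE.
  by case: (j =P i) => [->|_]; rewrite ?iA ?addbF.
move=> e; rewrite blade_sign_symdiffl !blade_sign_symdiffr e.
have -> : bsign [set i] [set i] = 1 by rewrite /blade_sign !big_set1 ltnn.
rewrite mulr1 -mulrA blade_sign_comm.
have -> : B :&: [set i] = set0.
  by apply/setP=> j; rewrite !inE; case: (j =P i); rewrite ?andbF.
by rewrite cards0 cards1 muln1 addn0 binS bin1 exprD.
Qed.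

Lemma bladeN1_coef_set2 (i j : 'I_n) : i != j ->
  bcoef [set i; j] [set i; j] = -1.
Proof.
move=> nij; rewrite bladeN1_coef_diag cards2 nij.
by rewrite -signr_odd (_ : odd _ = true) // expr1.
Qed.

End BladeSigns.

(** * Pairing on the exterior algebra *)

Section Exterior.
Variables (F : numFieldType) (n : nat).

Local Notation E := (@clifford F n (fun=> 0)).
Local Notation gen i := (blade (fun=> 0) [set i] : E).
Local Notation coef0 := (@blade_coef F n (fun=> 0)).
Implicit Types (x y t : E) (M K L : 'M[F]_n) (B C : {set 'I_n}).

(** Blades are orthonormal for this form; pairing products with [t] plays the role of the
    coefficients t_ijkl. *)
Definition ext_pair x y : F := \sum_A x A * y A.

Lemma ext_pairC x y : ext_pair x y = ext_pair y x.
Proof. by apply: eq_bigr => A _; rewrite mulrC. Qed.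

Fact ext_pair_is_linear x : linear (ext_pair x : E -> F^o).
Proof.
move=> a y z; rewrite /ext_pair scaler_sumr -big_split; apply: eq_bigr => A _.
by rewrite !ffunE /GRing.scale /=; ring.
Qed.
HB.instance Definition _ x := GRing.isSemilinear.Build F E F^o _
  (ext_pair x : E -> F^o) (GRing.semilinear_linear (ext_pair_is_linear x)).

Lemma ext_pair_blade x A : ext_pair x (blade _ A) = x A.
Proof.
rewrite /ext_pair (bigD1 A) //= big1 => [|C /negPf nC].
  by rewrite ffunE eqxx mulr1 addr0.
by rewrite ffunE nC mulr0.
Qed.

Lemma ext_genM i y C :
  (gen i * y) C = coef0 [set i] (symdiff [set i] C) * y (symdiff [set i] C).
Proof.
rewrite ffunE (bigD1 [set i]) //= big1 => [|A /negPf nA].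
  by rewrite ffunE eqxx mul1r addr0 mulrC.
by rewrite ffunE nA !mul0r.
Qed.

(** Interior product by the i-th coordinate form, written as the transpose of left multiplication by
    [gen i]. *)
Definition contract i y : E :=
  [ffun C => coef0 [set i] C * (y (symdiff [set i] C) : F)].

Fact contract_is_linear i : linear (contract i).
Proof.
by move=> a y z; apply/ffunP=> A; rewrite !ffunE /GRing.scale /=; ring.
Qed.
HB.instance Definition _ i := GRing.isSemilinear.Build F E E _
  (contract i) (GRing.semilinear_linear (contract_is_linear i)).

Lemma ext_pair_genM i x y : ext_pair (gen i * x) y = ext_pair x (contract i y).
Proof.
rewrite /ext_pair (reindex_inj (can_inj (symdiffK [set i]))).
by apply: eq_bigr => C _; rewrite ext_genM symdiffK ffunE; ring.
Qed.

Lemma coef0_set1 i B : coef0 [set i] B = blade_sign F [set i] B * (i \notin B)%:R.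
Proof.
rewrite /blade_coef; case: (boolP (i \in B)) => iB; last first.
  rewrite big1 // => j; rewrite !inE => /andP[/eqP-> iB'].
  by rewrite iB' in iB.
by rewrite (bigD1 i) ?inE ?eqxx //= mul0r !mulr0.
Qed.

(** The antiderivation rule; with [contract1] it computes [contract i] on words. *)
Lemma contract_genM i j y :
  contract i (gen j * y) = (i == j)%:R *: y - gen j * contract i y.
Proof.
apply/ffunP=> B; rewrite ffunE ext_genM.
have -> : ((i == j)%:R *: y - gen j * contract i y) B =
    (i == j)%:R * y B - coef0 [set j] (symdiff [set j] B) *
      (coef0 [set i] (symdiff [set j] B) * y (symdiff [set i] (symdiff [set j] B))).
  by rewrite [LHS]ffunE ffunE [X in _ + X]ffunE ext_genM ffunE.
have -> : symdiff [set i] (symdiff [set j] B) = symdiff [set j] (symdiff [set i] B).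
  by rewrite !symdiffA (symdiffC [set i]).
rewrite !coef0_set1 !blade_sign_symdiffr !in_symdiff !inE eqxx /=.
have [<-|nij] := eqVneq i j.
  rewrite symdiffK mul1r.
  have -> : blade_sign F [set i] [set i] = 1 by rewrite /blade_sign !big_set1 ltnn.
  have := blade_sign_sqr F [set i] B.
  by case: (i \in B) => /= s2; ring: s2.
rewrite mul0r sub0r.
have -> : blade_sign F [set i] [set j] = - blade_sign F [set j] [set i].
  rewrite /blade_sign !big_set1; case: ltngtP nij; rewrite ?opprK //.
  by move=> /val_inj->; rewrite eqxx.
have -> : blade_sign F [set j] [set j] = 1 by rewrite /blade_sign !big_set1 ltnn.
by case: (i \in B); case: (j \in B) => /=; ring.
Qed.

(** The image under [M] of the j-th basis vector. *)
Definition ext_line M j : E := \sum_i M i j *: gen i.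

Lemma ext_line_anticomm M j K k :
  ext_line M j * ext_line K k = - (ext_line K k * ext_line M j).
Proof.
rewrite /ext_line mulr_suml mulr_sumr -sumrN; apply: eq_bigr => i _.
rewrite mulr_suml mulr_sumr -sumrN; apply: eq_bigr => l _.
rewrite -!scalerAl -!scalerAr !scalerA mulrC -scalerN; congr (_ *: _).
have [->|nil] := eqVneq i l; last exact: gen_anticomm.
by rewrite gen_sqr scale0r oppr0.
Qed.

Lemma ext_line_sqr M j : ext_line M j * ext_line M j = 0%:A.
Proof.
have /eqP := ext_line_anticomm M j M j.
rewrite scale0r -addr_eq0 -mulr2n -scaler_nat scaler_eq0 pnatr_eq0 /=.
by move/eqP.
Qed.

(** The algebra endomorphism induced by [M]; the universal property applies because images of
    generators anticommute and square to 0. *)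
Definition ext_endo M : E -> E := cl_lift (q := fun=> 0) (ext_line M).
HB.instance Definition _ M := GRing.Linear.on (ext_endo M).

Lemma ext_endoM M x y : ext_endo M (x * y) = ext_endo M x * ext_endo M y.
Proof.
apply: cl_liftM => [j|i j _]; first exact: ext_line_sqr.
exact: ext_line_anticomm.
Qed.

Lemma ext_endo1 M : ext_endo M 1 = 1.
Proof.
rewrite /ext_endo -[1]/(blade (fun=> 0) set0) cl_lift_blade.
by rewrite enum_set0 big_nil.
Qed.

Lemma ext_endo_gen M j : ext_endo M (gen j) = ext_line M j.
Proof. by rewrite /ext_endo cl_lift_blade enum_set1 big_seq1. Qed.

(** All words are allowed, not only the sorted ones of the blade basis, so that an induction can put
    any letter in front. *)
Lemma clifford_word_ind (q : 'I_n -> F) (V : lmodType F)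
    (f g : {linear clifford q -> V}) :
  (forall s : seq 'I_n,
     f (\prod_(i <- s) blade q [set i]) = g (\prod_(i <- s) blade q [set i])) ->
  f =1 g.
Proof.
move=> fg x; rewrite [x]cl_basis !linear_sum; apply: eq_bigr => A _.
by rewrite !linearZ /= blade_prod fg.
Qed.

Lemma contract1 i : contract i 1 = 0.
Proof.
apply/ffunP=> B; rewrite !ffunE coef0_set1.
case: eqP => [|_]; last by rewrite mulr0.
by move/setP/(_ i); rewrite in_symdiff !inE eqxx; case: (i \in B) => // _; rewrite mulr0 mul0r.
Qed.

(** Interior product by the i-th coordinate form composed with [M^T]. *)
Definition contract_col M i y : E := \sum_k M k i *: contract k y.

Fact contract_col_is_linear M i : linear (contract_col M i).
Proof.
move=> a x y; rewrite /contract_col scaler_sumr -big_split; apply: eq_bigr => k _.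
by rewrite linearP /= scalerDr !scalerA mulrC.
Qed.
HB.instance Definition _ M i := GRing.isSemilinear.Build F E E _
  (contract_col M i) (GRing.semilinear_linear (contract_col_is_linear M i)).

(** Naturality of the interior product: both sides obey the same antiderivation rule along a
    word. *)
Lemma contract_endo M i y :
  contract i (ext_endo M^T y) = ext_endo M^T (contract_col M i y).
Proof.
move: y; apply: (@clifford_word_ind _ _ (contract i \o ext_endo M^T)
  (ext_endo M^T \o contract_col M i)) => s /=.
elim: s => [|j s IH].
  rewrite !big_nil ext_endo1 contract1 /contract_col big1 ?linear0 // => k _.
  by rewrite contract1 scaler0.
rewrite big_cons ext_endoM ext_endo_gen.
set y := \prod_(k <- s) _ in IH *.
transitivity (M j i *: ext_endo M^T y - ext_line M^T j * contract i (ext_endo M^T y)).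
  rewrite {1}/ext_line mulr_suml linear_sum (eq_bigr (fun k =>
    (M j k * (i == k)%:R) *: ext_endo M^T y -
    M j k *: (gen k * contract i (ext_endo M^T y)))); last first.
    by move=> k _; rewrite mxE -scalerAl linearZ /= contract_genM scalerBr scalerA.
  rewrite sumrB (bigD1 i) //= big1 => [|k /negPf nk]; last first.
    by rewrite eq_sym nk mulr0 scale0r.
  rewrite eqxx mulr1 addr0; congr (_ - _).
  by rewrite /ext_line mulr_suml; apply: eq_bigr => k _; rewrite mxE scalerAl.
have -> : contract_col M i (gen j * y) = M j i *: y - gen j * contract_col M i y.
  rewrite /contract_col (eq_bigr (fun k => (M k i * (k == j)%:R) *: y -
    gen j * (M k i *: contract k y))); last first.
    by move=> k _; rewrite contract_genM scalerBr scalerA scalerAr.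
  rewrite sumrB -mulr_sumr (bigD1 j) //= big1 => [|k /negPf nk]; last first.
    by rewrite nk mulr0 scale0r.
  by rewrite eqxx mulr1 addr0.
by rewrite linearB linearZ /= ext_endoM ext_endo_gen IH.
Qed.

Lemma ext_pair_lineM M j x y :
  ext_pair (ext_line M j * x) y = ext_pair x (contract_col M j y).
Proof.
rewrite /ext_line /contract_col mulr_suml ext_pairC !linear_sum.
apply: eq_bigr => k _; rewrite -scalerAl !linearZ /=; congr (_ * _).
by rewrite ext_pairC ext_pair_genM.
Qed.

(** The letters of [x] are moved one by one to [y] as contractions, which [contract_endo] carries
    through the endomorphism, until [x = 1]. *)
Lemma ext_pair_endo M x y : ext_pair (ext_endo M x) y = ext_pair x (ext_endo M^T y).
Proof.
rewrite ext_pairC [RHS]ext_pairC.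
move: x; apply: (@clifford_word_ind _ F^o (ext_pair y \o ext_endo M)
  (ext_pair (ext_endo M^T y))) => s /=.
rewrite ext_pairC [RHS]ext_pairC.
elim: s y => [|j s IH] y; last first.
  rewrite big_cons ext_endoM ext_endo_gen.
  by rewrite ext_pair_lineM IH -contract_endo ext_pair_genM.
(* Only the constant term of [y] now counts: a word with a first letter pairs to 0 with 1, as
   contractions kill 1. *)
rewrite !big_nil ext_endo1.
move: y; apply: (@clifford_word_ind _ F^o (ext_pair 1)
  (ext_pair 1 \o ext_endo M^T)) => s /=.
case: s => [|j s]; first by rewrite big_nil ext_endo1.
rewrite big_cons ext_endoM ext_endo_gen ext_pairC [RHS]ext_pairC.
rewrite ext_pair_genM ext_pair_lineM.
rewrite contract1 linear0; set z := ext_endo _ _.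
rewrite (_ : contract_col _ _ _ = 0) ?linear0 //.
by rewrite /contract_col big1 // => k _; rewrite contract1 scaler0.
Qed.

(** The bivector of a bilinear form; only the antisymmetric part of [K] matters. *)
Definition ext2 K : E := \sum_i \sum_j K i j *: (gen i * gen j).

Fact ext2_is_linear : linear ext2.
Proof.
move=> a K L; rewrite /ext2 scaler_sumr -big_split; apply: eq_bigr => i _ /=.
rewrite scaler_sumr -big_split; apply: eq_bigr => j _ /=.
by rewrite !mxE scalerDl scalerA.
Qed.
HB.instance Definition _ := GRing.isSemilinear.Build F 'M[F]_n E _ ext2
  (GRing.semilinear_linear ext2_is_linear).

Lemma ext_gen_anticomm i j : gen i * gen j = - (gen j * gen i).
Proof.
have [->|nij] := eqVneq i j; last exact: gen_anticomm.
by rewrite gen_sqr scale0r oppr0.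
Qed.

Lemma ext2_sym K : K^T = K -> ext2 K = 0.
Proof.
move=> KT; have /eqP : ext2 K = - ext2 K.
  rewrite {1}/ext2 exchange_big -sumrN; apply: eq_bigr => i _.
  rewrite -sumrN; apply: eq_bigr => j _.
  by rewrite ext_gen_anticomm scalerN -{1}KT mxE.
rewrite -addr_eq0 -mulr2n -scaler_nat scaler_eq0 pnatr_eq0 /=.
by move/eqP.
Qed.

Lemma ext_endo_ext2 M K : ext_endo M^T (ext2 K) = ext2 (M^T *m K *m M).
Proof.
rewrite /ext2 linear_sum.
transitivity (\sum_i \sum_j \sum_a \sum_b
    (K i j * M i a * M j b) *: (gen a * gen b)).
  apply: eq_bigr => i _; rewrite linear_sum; apply: eq_bigr => j _.
  rewrite linearZ /= ext_endoM !ext_endo_gen /ext_line mulr_suml scaler_sumr.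
  apply: eq_bigr => a _; rewrite mulr_sumr scaler_sumr; apply: eq_bigr => b _.
  by rewrite !mxE -scalerAl -scalerAr !scalerA.
rewrite (eq_bigr (fun i => \sum_a \sum_j \sum_b
    (K i j * M i a * M j b) *: (gen a * gen b))); last first.
  by move=> i _; rewrite exchange_big.
rewrite exchange_big; apply: eq_bigr => a _.
rewrite (eq_bigr (fun i => \sum_b \sum_j
    (K i j * M i a * M j b) *: (gen a * gen b))); last first.
  by move=> i _; rewrite exchange_big.
rewrite exchange_big; apply: eq_bigr => b _ /=.
rewrite mxE scaler_suml exchange_big; apply: eq_bigr => j _ /=.
rewrite mxE mulr_suml scaler_suml; apply: eq_bigr => i _.
by rewrite mxE; congr (_ *: _); ring.
Qed.

(** Exchanging [gen j] and [gen k] costs one sign; this is how alternation enters the Fierz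
    argument. *)
Lemma ext2_mul_swap K L :
  \sum_i \sum_j \sum_k \sum_l (K i k * L j l) *: (gen i * gen j * gen k * gen l) =
  - (ext2 K * ext2 L).
Proof.
rewrite /ext2 mulr_suml -sumrN; apply: eq_bigr => i _.
rewrite exchange_big mulr_suml -sumrN; apply: eq_bigr => k _ /=.
rewrite mulr_sumr -sumrN; apply: eq_bigr => j _.
rewrite mulr_sumr -sumrN; apply: eq_bigr => l _.
rewrite -scalerAl -scalerAr scalerA -scalerN; congr (_ *: _).
by rewrite -[gen i * gen j * _]mulrA ext_gen_anticomm mulrN mulNr !mulrA.
Qed.

Definition ext_deg4 t := forall B, #|B| != 4 -> t B = 0.

Lemma ext_pair4_eq0 t : ext_deg4 t ->
  (forall i j k l, ext_pair t (gen i * gen j * (gen k * gen l)) = 0) -> t = 0.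
Proof.
move=> t4 t0; apply/ffunP=> A; rewrite ffunE.
have [cA|] := eqVneq #|A| 4; last exact: t4.
rewrite -[LHS]ext_pair_blade blade_prod; have : size (enum A) = 4 by rewrite -cardE.
case: (enum A) => [|i [|j [|k [|l []]]]] // _.
by rewrite !big_cons big_nil mulr1 mulrA.
Qed.

Lemma ext_deg4_ind (V : lmodType F) (f g : {linear E -> V}) t : ext_deg4 t ->
  (forall i j k l, f (gen i * gen j * gen k * gen l) = g (gen i * gen j * gen k * gen l)) ->
  f t = g t.
Proof.
move=> t4 fg; rewrite [t]cl_basis !linear_sum; apply: eq_bigr => A _.
rewrite !linearZ /=; have [cA|/t4->] := eqVneq #|A| 4; last by rewrite !scale0r.
congr (_ *: _); rewrite blade_prod; have : size (enum A) = 4 by rewrite -cardE.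
case: (enum A) => [|i [|j [|k [|l []]]]] // _.
by rewrite !big_cons big_nil mulr1 !mulrA fg.
Qed.

Lemma ext_lineZ a M j : ext_line (a *: M) j = a *: ext_line M j.
Proof.
by rewrite /ext_line scaler_sumr; apply: eq_bigr => i _; rewrite mxE scalerA.
Qed.

Lemma ext_endoZ4 a M t : ext_deg4 t -> ext_endo (a *: M) t = a ^+ 4 *: ext_endo M t.
Proof.
move=> t4; apply: (@ext_deg4_ind _ (ext_endo (a *: M))
  ((a ^+ 4 : F) \*: ext_endo M)) t4 _ => i j k l /=.
rewrite !ext_endoM !ext_endo_gen !ext_lineZ.
by do 4 rewrite -?scalerAl -?scalerAr; rewrite !scalerA; congr (_ *: _); ring.
Qed.

(** The eigenvalue is the fourth power of sqrt 2: [M] will be sqrt 2 times the matrix of a spin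
    element, acting in degree 4. *)
Lemma ext_pair_ext2_invariant M t K L : ext_endo M t = 4 *: t ->
  4 * ext_pair t (ext2 K * ext2 L) =
  ext_pair t (ext2 (M^T *m K *m M) * ext2 (M^T *m L *m M)).
Proof.
move=> Mt; rewrite -!ext_endo_ext2 -ext_endoM -ext_pair_endo Mt.
by rewrite ext_pairC [RHS]ext_pairC linearZ.
Qed.

Lemma ext_pair_ext2_eq0 t : ext_deg4 t ->
  (forall K L, ext_pair t (ext2 K * ext2 L) = 0) -> t = 0.
Proof.
have ext2_delta i j : ext2 (delta_mx i j) = gen i * gen j.
  rewrite /ext2 (bigD1 i) //= [X in _ + X]big1 => [|k /negPf nk]; last first.
    by rewrite big1 // => l _; rewrite mxE nk scale0r.
  rewrite addr0 (bigD1 j) //= big1 => [|l /negPf nl].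
    by rewrite mxE !eqxx scale1r addr0.
  by rewrite mxE nl andbF scale0r.
by move=> t4 t0; apply: ext_pair4_eq0 => // i j k l; rewrite -!ext2_delta.
Qed.

End Exterior.

(** * The Fierz identity *)

Lemma odd_card_symdiff n (A B : {set 'I_n}) :
  odd #|symdiff A B| = odd #|A| (+) odd #|B|.
Proof.
rewrite /symdiff cardsU (_ : _ :&: _ = set0); last first.
  by apply/setP=> i; rewrite !inE; case: (i \in A); case: (i \in B).
rewrite cards0 subn0 -(cardsID B A) -(cardsID A B) [B :&: A]setIC !oddD.
by case: (odd _); case: (odd _); case: (odd _).
Qed.

Section EvenCliffordModule.
Variables (R : realFieldType) (m n : nat) (M : {set 'I_m} -> 'M[R]_n).
Implicit Types (A B D : {set 'I_m}) (K L X Y : 'M[R]_n).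

Local Notation bcoef := (@blade_coef R m (fun=> -1)).
Local Notation even A := (~~ odd #|A|).

Hypothesis M0 : M set0 = 1%:M.
Hypothesis MM : forall A B, even A -> even B ->
  M A *m M B = bcoef A B *: M (symdiff A B).
Hypothesis M_commutant : forall X,
  (forall A, even A -> X *m M A = M A *m X) -> exists c, X = c%:M.

(** For even [A] and [B], the sign in e_A e_B = ± e_B e_A. *)
Definition bchar A B : R := (-1) ^+ #|A :&: B|.

Lemma even_symdiff A B : even A -> even B -> even (symdiff A B).
Proof. by rewrite odd_card_symdiff; case: odd; case: odd. Qed.

Lemma even_comm A B : even A -> even B ->
  M A *m M B = bchar A B *: (M B *m M A).
Proof.
move=> eA eB; rewrite !MM // bladeN1_coefC symdiffC scalerA; congr (_ * _ *: _).
by rewrite exprD -signr_odd oddM (negPf eA) mul1r.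
Qed.

Lemma even_sqr A : even A -> M A *m M A = (bcoef A A)%:M.
Proof. by move=> eA; rewrite MM // symdiffxx M0 scalemx1. Qed.

(** The standard scalar product averaged over the finite group of all ± M_A. *)
Definition spin_form : 'M[R]_n := \sum_(A : {set 'I_m} | even A) (M A)^T *m M A.
Local Notation J := spin_form.

Lemma spin_form_sym : J^T = J.
Proof.
rewrite /J linear_sum; apply: eq_bigr => A _.
by rewrite /= trmx_mul trmxK.
Qed.

Lemma spin_form_invariant A : even A -> (M A)^T *m J *m M A = J.
Proof.
move=> eA; rewrite /J mulmx_sumr mulmx_suml.
rewrite [RHS](reindex_inj (can_inj (symdiffK A))).
apply: eq_big => [B|B eB]; first by rewrite odd_card_symdiff (negPf eA).
rewrite mulmxA -trmx_mul -mulmxA MM // -scalemxAr [(_ *: _)^T]linearZ -scalemxAl /= scalerA.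
by rewrite bladeN1_coef_sqr scale1r symdiffC.
Qed.

(** Hence J M_A is symmetric or antisymmetric according to the sign of the square of e_A. *)
Lemma spin_form_adj A : even A -> (M A)^T *m J = bcoef A A *: (J *m M A).
Proof.
move=> eA; rewrite -{2}(spin_form_invariant eA) -[_ *m M A *m M A]mulmxA.
by rewrite even_sqr // mul_mx_scalar scalerA bladeN1_coef_sqr scale1r.
Qed.

(** [J] is positive definite: v J v^T is a sum of squares, whose term at [set0] is the squared norm
    of [v]. *)
Lemma spin_form_unit : J \in unitmx.
Proof.
rewrite -row_free_unit; apply/inj_row_free => v vJ.
have sqE (w : 'cV[R]_n) : (w^T *m w) 0 0 = \sum_i w i 0 ^+ 2.
  by rewrite mxE; apply: eq_bigr => i _; rewrite mxE.
have : \sum_(A : {set 'I_m} | even A) ((M A *m v^T)^T *m (M A *m v^T)) 0 0 = 0.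
  transitivity ((v *m J *m v^T) 0 0); last by rewrite vJ mul0mx mxE.
  rewrite /J mulmx_sumr mulmx_suml summxE; apply: eq_bigr => A _.
  by rewrite trmx_mul trmxK !mulmxA.
move/psumr_eq0P => /(_ _ set0); rewrite cards0 M0 mul1mx sqE => v0.
apply/rowP=> i; rewrite mxE; apply/eqP; rewrite -sqrf_eq0; apply/eqP.
have /psumr_eq0P/(_ i isT) : \sum_i v^T i 0 ^+ 2 = 0.
  by apply: v0 => // A _; rewrite sqE sumr_ge0 // => j _; rewrite sqr_ge0.
by rewrite mxE; apply=> j _; rewrite sqr_ge0.
Qed.

(** The average [Psi Y] over the group satisfies that Psi Y J commutes with every even M_D, so it is
    a scalar by [M_commutant]; the trace determines it, and [c] is the number of even sets over
    [n]. *)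
Lemma fierz_mx : exists2 c : R, c != 0 & forall Y,
  \sum_(A : {set 'I_m} | even A) J *m M A *m Y *m (J *m M A)^T = (c * \tr (Y *m J)) *: J.
Proof.
pose Psi Y := \sum_(A : {set 'I_m} | even A) M A *m Y *m (M A)^T.
have PsiJ Y D : even D -> Psi Y *m J *m M D = M D *m (Psi Y *m J).
  move=> eD; have {2}-> : Psi Y = (M D) *m Psi Y *m (M D)^T.
    rewrite /Psi mulmx_sumr mulmx_suml (reindex_inj (can_inj (symdiffK D))).
    apply: eq_big => [A|A eA]; first by rewrite odd_card_symdiff (negPf eD).
    have eA' : even A by move: eA; rewrite odd_card_symdiff (negPf eD).
    rewrite !mulmxA MM // -!mulmxA -trmx_mul MM // [(_ *: _)^T]linearZ /=.
    by rewrite -scalemxAl -!scalemxAr scalerA bladeN1_coef_sqr scale1r.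
  rewrite -!mulmxA spin_form_adj // !mulmxA -!scalemxAr.
  by rewrite even_sqr // -!mulmxA mul_scalar_mx scalerA bladeN1_coef_sqr scale1r.
(* Without entries any non-zero constant will do. *)
have [n0|n_gt0] := posnP n.
  exists 1 => [|Y]; first exact: oner_neq0.
  by apply/matrixP=> i; have := leq_trans (ltn_ord i) (eq_leq n0).
exists ((\sum_(A : {set 'I_m} | even A) 1) / n%:R) => [|Y].
  rewrite mulf_neq0 ?invr_eq0 ?pnatr_eq0 -?lt0n // sumr_const pnatr_eq0 -lt0n.
  by apply/card_gt0P; exists set0; rewrite unfold_in cards0.
have [c PsiYJ] := M_commutant (PsiJ Y).
have trc : c * n%:R = (\sum_(A : {set 'I_m} | even A) 1) * \tr (Y *m J).
  have -> : c * n%:R = \tr (Psi Y *m J) by rewrite PsiYJ mxtrace_scalar mulr_natr.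
  rewrite /Psi mulmx_suml linear_sum mulr_suml; apply: eq_bigr => A eA.
  by rewrite mul1r -!mulmxA /= mxtrace_mulC -!mulmxA [X in _ *m X]mulmxA spin_form_invariant.
have -> : (\sum_(A : {set 'I_m} | even A) 1) / n%:R * \tr (Y *m J) = c.
  by rewrite mulrAC -trc mulfK // pnatr_eq0 -lt0n.
rewrite -mul_mx_scalar -PsiYJ /Psi [X in _ *m X]mulmx_suml [RHS]mulmx_sumr.
by apply: eq_bigr => A _; rewrite trmx_mul spin_form_sym !mulmxA.
Qed.

(** The entry (i, k) of [fierz_mx] at the elementary matrix [delta_mx j l]. *)
Lemma fierz : exists2 c : R, c != 0 & forall i j k l,
  \sum_(A : {set 'I_m} | even A) (J *m M A) i j * (J *m M A) k l = c * (J i k * J j l).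
Proof.
have [c c0 cP] := fierz_mx; exists c => // i j k l.
have := congr1 (fun X : 'M_n => X i k) (cP (delta_mx j l)).
rewrite summxE mxE => e; transitivity (c * \tr (delta_mx j l *m J) * J i k).
  rewrite -e; apply: eq_bigr => A _.
  rewrite [LHS](_ : _ = (col j (J *m M A) *m row l (J *m M A)^T) i k).
    rewrite colE rowE !mulmxA -[_ *m delta_mx j 0 *m delta_mx 0 l]mulmxA.
    by rewrite mul_delta_mx.
  by rewrite [RHS]mxE big_ord1 [col _ _ _ _]mxE [row _ _ _ _]mxE [_^T _ _]mxE.
rewrite -(mul_delta_mx (0 : 'I_1)) -mulmxA mxtrace_mulC -rowE -colE.
rewrite /mxtrace big_ord1 -{1}spin_form_sym !mxE; ring.
Qed.

(** Contracting the Fierz identity in k, l with J^-1 K J^-1 leaves [K] on one side and a combination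
    of the J M_A on the other. *)
Lemma spin_form_span K : exists x : {set 'I_m} -> R,
  K = \sum_(A : {set 'I_m} | even A) x A *: (J *m M A).
Proof.
have [c c0 cP] := fierz; pose X := invmx J *m K *m invmx J.
have {1}-> : K = J *m X *m J^T.
  rewrite spin_form_sym /X !mulmxA mulmxV ?spin_form_unit // mul1mx.
  by rewrite mulmxKV // spin_form_unit.
exists (fun A => \sum_l \sum_k c^-1 * X k l * (J *m M A) k l).
apply/matrixP=> i j; rewrite [LHS]mxE summxE.
transitivity (\sum_l \sum_k \sum_(A : {set 'I_m} | even A)
    c^-1 * X k l * ((J *m M A) k l * (J *m M A) i j)).
  apply: eq_bigr => l _; rewrite [(J *m X) i l]mxE mulr_suml; apply: eq_bigr => k _.
  have Jsym a b : J a b = J b a by rewrite -{1}spin_form_sym mxE.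
  rewrite -mulr_sumr cP [_^T _ _]mxE (Jsym i) (Jsym j).
  by rewrite [RHS]mulrACA mulVf // mul1r; ring.
rewrite (eq_bigr _ (fun l _ => exchange_big _ _ _ _ _ _)) exchange_big /=.
apply: eq_bigr => A _; rewrite [RHS]mxE mulr_suml; apply: eq_bigr => l _.
by rewrite mulr_suml; apply: eq_bigr => k _; rewrite mulrA.
Qed.

(** Congruence by M_B multiplies J M_A by [bchar A B]; applied to the indices k and l of [fierz], it
    turns J_ik J_jl into the same product for J M_B. *)
Lemma fierz_char : exists c : R, forall B, even B -> forall i j k l,
  \sum_(A : {set 'I_m} | even A) bchar A B * ((J *m M A) i j * (J *m M A) k l) =
  c * ((J *m M B) i k * (J *m M B) j l).
Proof.
have [c _ cP] := fierz; exists c => B eB i j k l.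
have twist A : even A ->
    bchar A B *: (J *m M A) = (M B)^T *m (J *m M A) *m M B.
  move=> eA; rewrite mulmxA spin_form_adj // -!scalemxAl -[J *m M B *m M A]mulmxA.
  rewrite (even_comm eB eA) -scalemxAr -scalemxAl -!mulmxA even_sqr //.
  rewrite mul_mx_scalar -!scalemxAr !scalerA /bchar setIC mulrAC.
  by rewrite bladeN1_coef_sqr mul1r.
rewrite (eq_bigr (fun A : {set 'I_m} => \sum_(b : 'I_n) \sum_(a : 'I_n) M B a k * M B b l *
    ((J *m M A) i j * (J *m M A) a b))); last first.
  move=> A eA; transitivity ((J *m M A) i j * (bchar A B *: (J *m M A)) k l).
    by rewrite [X in _ = _ * X]mxE; ring.
  rewrite twist // [(_ *m M B) k l]mxE mulr_sumr; apply: eq_bigr => b _.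
  rewrite [(_^T *m _) k b]mxE mulr_suml mulr_sumr; apply: eq_bigr => a _.
  by rewrite [_^T _ _]mxE; ring.
rewrite exchange_big [(J *m M B) j l]mxE !mulr_sumr; apply: eq_bigr => b _ /=.
rewrite exchange_big [(J *m M B) i k]mxE mulr_suml mulr_sumr.
apply: eq_bigr => a _ /=; rewrite -mulr_sumr cP; ring.
Qed.

(** * The form G of an invariant 4-vector *)

Section InvariantForm.
Variable t : @clifford R n (fun=> 0).
Hypothesis t4 : ext_deg4 t.
Hypothesis t_inv : forall i j, i != j -> ext_endo (1%:M + M [set i; j]) t = 4 *: t.

Definition form_coef A B : R := ext_pair t (ext2 (J *m M A) * ext2 (J *m M B)).

Lemma even_set2 (i j : 'I_m) : i != j -> even [set i; j].
Proof. by move=> nij; rewrite cards2 nij. Qed.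

Lemma bchar_set2 A i j : i != j ->
  bchar A [set i; j] = (-1) ^+ ((i \in A) (+) (j \in A)).
Proof.
move=> nij; rewrite /bchar -signr_odd; congr (_ ^+ nat_of_bool _).
have -> : #|A :&: [set i; j]| = ((i \in A) + (j \in A))%N.
  rewrite -sum1_card big_mkcond (bigD1 i) //= (bigD1 j) ?(eq_sym j) //= big1.
    by rewrite !inE !eqxx orbT !andbT addn0; do 2 case: (_ \in A).
  by move=> k /andP[/negPf nki /negPf nkj]; rewrite !inE nki nkj andbF.
by rewrite oddD !oddb.
Qed.

(** Since M_D is skew for [J], the congruence is J (1 - M_D) M_A (1 + M_D) with D = {i, j}. As M_D
    squares to -1, it gives 2 J M_A if M_D and M_A commute, and 2 J M_A M_D if they anticommute. *)
Lemma rotate_form i j A : i != j -> even A ->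
  (1%:M + M [set i; j])^T *m (J *m M A) *m (1%:M + M [set i; j]) =
  if (i \in A) (+) (j \in A)
  then 2 *: (bcoef A [set i; j] *: (J *m M (symdiff A [set i; j])))
  else 2 *: (J *m M A).
Proof.
move=> nij eA; have eD := even_set2 nij; set D := [set i; j] in eD *.
have DD : bcoef D D = -1 by exact: bladeN1_coef_set2.
have -> : (1%:M + M D)^T *m (J *m M A) = J *m M A - J *m (M D *m M A).
  rewrite linearD /= trmx1 mulmxDl mul1mx mulmxA spin_form_adj // DD.
  by rewrite scaleN1r mulNmx mulmxA.
rewrite (even_comm eD eA) mulmxDr mulmx1 -scalemxAr mulmxBl -scalemxAl -!mulmxA.
rewrite (even_sqr eD) DD (MM eA eD) -scalemxAr mul_mx_scalar scaleN1r mulmxN.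
have -> : bchar D A = (-1) ^+ ((i \in A) (+) (j \in A)).
  by rewrite /bchar setIC -bchar_set2.
case: ifP => _; rewrite ?expr1 ?expr0 ?scaleN1r ?scale1r ?opprK.
  by rewrite scaler_nat mulr2n [X in _ + X]addrC addrACA subrr add0r.
by rewrite scaler_nat mulr2n addrA subrK.
Qed.

(** The factor 2 from each argument cancels the eigenvalue 4. *)
Lemma form_coef_rotate A B i j : i != j -> even A -> even B ->
  let D := [set i; j] in
  form_coef A B =
  (if (i \in A) (+) (j \in A) then bcoef A D else 1) *
  (if (i \in B) (+) (j \in B) then bcoef B D else 1) *
  form_coef (if (i \in A) (+) (j \in A) then symdiff A D else A)
            (if (i \in B) (+) (j \in B) then symdiff B D else B).
Proof.
move=> nij eA eB D; have n4 : 4 != 0 :> R by rewrite pnatr_eq0.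
apply: (mulfI n4).
rewrite [LHS](ext_pair_ext2_invariant _ _ (t_inv nij)).
rewrite !rotate_form // -/D /form_coef.
case: ifP => _; case: ifP => _; rewrite ?mul1r !linearZ -!scalerAl -!scalerAr !linearZ /=;
  rewrite /GRing.scale /=; ring.
Qed.

Lemma form_coef_swap A i j : i != j -> even A -> (i \in A) (+) (j \in A) ->
  form_coef (symdiff A [set i; j]) (symdiff A [set i; j]) = form_coef A A.
Proof.
move=> nij eA ijA; rewrite [RHS](form_coef_rotate nij) // ijA.
by rewrite bladeN1_coef_sqr mul1r.
Qed.

(** With [i] inside the symmetric difference and [j] outside, exactly one of [A] and [B] separates
    [i] from [j]. Rotating twice multiplies that blade by the square of e_D, which is -1, and fixes
    the other, so G = - G. *)
Lemma form_coef_offdiag A B : even A -> even B ->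
  symdiff A B != set0 -> symdiff A B != setT -> form_coef A B = 0.
Proof.
move=> eA eB /set0Pn[i iAB]; rewrite -subTset => /subsetPn[j _ jAB].
have nij : i != j by apply: contraNneq jAB => <-.
have eD := even_set2 nij; set D := [set i; j] in eD *.
have DD C : bcoef C D * bcoef (symdiff C D) D = -1.
  by rewrite blade_coefA symdiffxx blade_coef0r mulr1 bladeN1_coef_set2.
have flip C : (i \in symdiff C D) (+) (j \in symdiff C D) = (i \in C) (+) (j \in C).
  by rewrite !in_symdiff !inE !eqxx orbT; do 2 case: (_ \in C).
have DK C : symdiff (symdiff C D) D = C by rewrite -symdiffA symdiffxx symdiff0.
have n2 : form_coef A B = - form_coef A B -> form_coef A B = 0.
  move/eqP; rewrite -addr_eq0 -mulr2n mulrn_eq0 /=.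
  by move/eqP.
have eB' := even_symdiff eB eD; have eA' := even_symdiff eA eD.
have [jA|jA] := boolP ((i \in A) (+) (j \in A)).
  have jB : (i \in B) (+) (j \in B) = false.
    by move: iAB jAB jA; rewrite !in_symdiff; do 4 case: (_ \in _).
  apply: n2; rewrite {1}(form_coef_rotate nij) // jA jB.
  rewrite (form_coef_rotate nij) // flip jA jB DK !mulr1 mulrA.
  by rewrite DD mulN1r.
have jB : (i \in B) (+) (j \in B).
  by move: iAB jAB jA; rewrite !in_symdiff; do 4 case: (_ \in _).
apply: n2; rewrite {1}(form_coef_rotate nij) // (negPf jA) jB.
rewrite (form_coef_rotate nij) // flip (negPf jA) jB DK !mul1r mulrA.
by rewrite DD mulN1r.
Qed.

(** An element of A \ B is traded for one of B \ A by [form_coef_swap], which shrinks A \ B. *)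
Lemma form_coef_card A B : even A -> #|A| = #|B| -> form_coef A A = form_coef B B.
Proof.
have [k] := ubnP #|A :\: B|; elim: k A => // k IH A.
rewrite ltnS => Ak eA cAB.
have cD : #|A :\: B| = #|B :\: A|.
  by apply/(@addnI #|A :&: B|); rewrite cardsID {1}[A :&: B]setIC cardsID.
have [A0|[i]] := set_0Vmem (A :\: B).
  suff -> : A = B by [].
  by apply/eqP; rewrite eqEcard cAB leqnn andbT -setD_eq0 A0.
rewrite inE => /andP[iB iA].
have [B0|[j]] := set_0Vmem (B :\: A).
  by move/eqP: cD; rewrite B0 cards0 cards_eq0 => /eqP/setP/(_ i); rewrite !inE iA iB.
rewrite inE => /andP[jA jB].
have nij : i != j by apply: contraNneq jA => <-.
have ijA : (i \in A) (+) (j \in A) by rewrite iA (negPf jA).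
have AE : symdiff A [set i; j] = j |: (A :\ i).
  apply/setP=> l; rewrite in_symdiff !inE.
  case: (l =P i) => [->|_]; first by rewrite (negPf nij) iA.
  by case: (l =P j) => [->|_] /=; rewrite ?addbF // (negPf jA).
rewrite -(form_coef_swap nij) //; apply: IH.
- rewrite AE; apply: leq_trans Ak; rewrite [X in (_ < X)%N](cardsD1 i) inE iA iB add1n ltnS.
  by apply/subset_leq_card/subsetP=> l; rewrite !inE; case: (l =P j) => [->|] //=;
    rewrite ?jB // => _; case/andP=> -> /andP[-> ->].
- exact/even_symdiff/even_set2.
- rewrite AE cardsU1 !inE (negPf jA) andbF add1n -cAB [RHS](cardsD1 i) iA.
  by [].
Qed.

(** Here J M_A is symmetric, so its bivector vanishes. *)
Lemma form_coef_sym A : even A -> bcoef A A = 1 -> form_coef A A = 0.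
Proof.
move=> eA AA; rewrite /form_coef ext2_sym ?mul0r ?linear0 //.
by rewrite trmx_mul spin_form_sym spin_form_adj // AA scale1r.
Qed.

(** The twisted Fierz identity followed by [ext2_mul_swap] turns the sum into a multiple of the
    square of the bivector of J M_B, which is 0 as J M_B is symmetric. *)
Lemma form_coef_fierz B : even B -> bcoef B B = 1 ->
  \sum_(A : {set 'I_m} | even A) bchar A B * form_coef A A = 0.
Proof.
move=> eB BB; have [c /(_ B eB) cP] := fierz_char.
pose gen i := blade (fun=> 0 : R) [set i : 'I_n].
have e : \sum_(A : {set 'I_m} | even A)
    bchar A B *: (ext2 (J *m M A) * ext2 (J *m M A)) = 0.
  transitivity (c *: \sum_i \sum_j \sum_k \sum_l
      ((J *m M B) i k * (J *m M B) j l) *: (gen i * gen j * gen k * gen l)).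
    transitivity (\sum_i \sum_j \sum_k \sum_l
      (\sum_(A : {set 'I_m} | even A) bchar A B * ((J *m M A) i j * (J *m M A) k l)) *:
         (gen i * gen j * gen k * gen l)).
      rewrite (eq_bigr (fun A : {set 'I_m} => \sum_i \sum_j \sum_k \sum_l
        (bchar A B * ((J *m M A) i j * (J *m M A) k l)) *:
         (gen i * gen j * gen k * gen l))); last first.
        move=> A eA; rewrite /ext2 mulr_suml scaler_sumr; apply: eq_bigr => i _.
        rewrite mulr_suml scaler_sumr; apply: eq_bigr => j _.
        rewrite mulr_sumr scaler_sumr; apply: eq_bigr => k _.
        rewrite mulr_sumr scaler_sumr; apply: eq_bigr => l _.
        by rewrite -scalerAl -scalerAr !scalerA mulrA [in LHS]mulrA.
      rewrite exchange_big; apply: eq_bigr => i _.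
      rewrite exchange_big; apply: eq_bigr => j _.
      rewrite exchange_big; apply: eq_bigr => k _.
      rewrite exchange_big; apply: eq_bigr => l _.
      by rewrite scaler_suml.
    rewrite scaler_sumr; apply: eq_bigr => i _.
    rewrite scaler_sumr; apply: eq_bigr => j _.
    rewrite scaler_sumr; apply: eq_bigr => k _.
    rewrite scaler_sumr; apply: eq_bigr => l _.
    by rewrite cP scalerA.
  rewrite ext2_mul_swap ext2_sym ?mul0r ?oppr0 ?scaler0 //.
  by rewrite trmx_mul spin_form_sym spin_form_adj // BB scale1r.
have := congr1 (ext_pair t) e; rewrite linear0 linear_sum => e0; rewrite -[RHS]e0.
by apply: eq_bigr => A _; rewrite linearZ.
Qed.

End InvariantForm.

End EvenCliffordModule.

(** * Vanishing of invariant 4-vectors *)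

Section Krawtchouk.
Variables (R : realFieldType) (n : nat).
Implicit Types A B : {set 'I_n}.

(** The value at |B| of the k-th binary Krawtchouk polynomial. *)
Definition krawtchouk B k : R := \sum_(A : {set 'I_n} | #|A| == k) bchar R A B.

(** Both sides expand the product over [i] of 1 - X for [i] in [B] and 1 + X otherwise. *)
Lemma krawtchouk_gen B :
  \sum_A bchar R A B *: 'X^#|A| = (1 - 'X) ^+ #|B| * (1 + 'X) ^+ (n - #|B|).
Proof.
transitivity (\prod_(i : 'I_n) ((if i \in B then - 'X else 'X) + 1) : {poly R}).
  rewrite bigA_distr; apply: eq_big => [A|A _]; first by rewrite inE.
  rewrite -big_mkcond /= (eq_bigr (fun i => (if i \in B then -1 else 1) * 'X)).
    rewrite big_split prodr_const /= -big_mkcondr /= prodr_const.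
    rewrite /bchar (_ : #|_| = #|A :&: B|); last by apply: eq_card => i; rewrite !inE.
    by rewrite -[in LHS]signr_odd -[in RHS]signr_odd scaler_sign mulr_sign.
  by move=> i _; case: ifP; rewrite ?mulN1r ?mul1r.
rewrite (bigID (mem B)) /=; congr (_ * _).
  rewrite (eq_bigr (fun=> 1 - 'X)) ?prodr_const // => i ->.
  by rewrite addrC.
rewrite (eq_bigr (fun=> 1 + 'X)) => [|i /negPf->]; last by rewrite addrC.
rewrite prodr_const; congr (_ ^+ _).
have Bn : (#|B| <= n)%N by have := max_card (mem B); rewrite card_ord.
by apply/eqP; rewrite -(eqn_add2l #|B|) subnKC //; have := cardC B; rewrite card_ord => /eqP.
Qed.

Lemma krawtchoukE B k :
  krawtchouk B k = ((1 - 'X) ^+ #|B| * (1 + 'X) ^+ (n - #|B|) : {poly R})`_k.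
Proof.
rewrite -krawtchouk_gen coef_sum /krawtchouk big_mkcond; apply: eq_bigr => A _.
by rewrite coefZ coefXn eq_sym; case: eqP; rewrite ?mulr1 ?mulr0.
Qed.

Lemma krawtchouk0 k : krawtchouk set0 k = 'C(n, k)%:R.
Proof.
have := card_draws 'I_n k; rewrite card_ord => <-.
rewrite /krawtchouk -sum1_card natr_sum.
apply: eq_big => [A|A _]; first by rewrite inE.
by rewrite /bchar setI0 cards0.
Qed.

End Krawtchouk.

Lemma krawtchouk_16_4_expansion (R : comNzRingType) :
  (1 - 'X) ^+ 4 * (1 + 'X) ^+ 12 =
  Poly [:: 1; 8; 24; 24; - 36; - 120; - 88; 88; 198; 88; - 88; - 120; - 36; 24; 24; 8; 1] :> {poly R}.
Proof.
(* Horner form makes the identity one between ring expressions in X. *)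
have PolyE c s : Poly (c :: s) = Poly s * 'X + c%:P :> {poly R}.
  exact: cons_poly_def.
rewrite !{}PolyE [Poly [::]]/(0 : {poly R}) !polyCN !polyC_natr polyC1.
by move: ('X) => x; ring.
Qed.

Lemma krawtchouk_16_4 (R : realFieldType) (B : {set 'I_16}) : #|B| = 4 ->
  [/\ krawtchouk R B 2 = 24, krawtchouk R B 14 = 24,
      krawtchouk R B 6 = - 88 & krawtchouk R B 10 = - 88].
Proof.
move=> cB; rewrite !krawtchoukE cB (_ : (16 - 4 = 12)%N) //.
by rewrite krawtchouk_16_4_expansion !coef_Poly.
Qed.

Lemma card_set16_exists k : (k <= 16)%N -> exists A : {set 'I_16}, #|A| = k.
Proof.
move=> k16; have := card_draws 'I_16 k; rewrite card_ord => e.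
have /card_gt0P[A] : (0 < #|[set A : {set 'I_16} | #|A| == k]|)%N.
  by rewrite e bin_gt0.
by rewrite inE => /eqP; exists A.
Qed.

(** The listed sizes are those congruent to 2 modulo 4; the other even sizes give blades of square
    1. *)
Lemma even_card16 k : (k <= 16)%N -> ~~ odd k ->
  k \in [:: 2; 14; 6; 10] \/ ~~ odd 'C(k.+1, 2).
Proof. by move: k; do 17![case; first by [left | right]]. Qed.

(** Only the values alpha at size 2 and beta at size 6 are free. The relations for [B] of sizes 4
    and 0 make two independent equations in them. *)
Lemma card_invariant_eq0 (R : realFieldType) (g : {set 'I_16} -> R) :
  let even (A : {set 'I_16}) := ~~ odd #|A| in
  (forall A B : {set 'I_16}, even A -> #|A| = #|B| -> g A = g B) ->
  (forall A, even A -> g (~: A) = g A) ->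
  (forall A, even A -> ~~ odd 'C(#|A|.+1, 2) -> g A = 0) ->
  (forall B, even B -> ~~ odd 'C(#|B|.+1, 2) ->
     \sum_(A : {set 'I_16} | even A) bchar R A B * g A = 0) ->
  forall A, even A -> g A = 0.
Proof.
move=> even gC gT g0 gB.
have [A2 c2] : exists B : {set 'I_16}, #|B| = 2 by exact: card_set16_exists.
have [A6 c6] : exists B : {set 'I_16}, #|B| = 6 by exact: card_set16_exists.
have [B cB] : exists B : {set 'I_16}, #|B| = 4 by exact: card_set16_exists.
have cC (C : {set 'I_16}) : #|~: C| = (16 - #|C|)%N by rewrite cardsCs setCK card_ord.
(* Sizes 14 and 10 are the complements of 2 and 6; the remaining even sizes fall under [g0]. *)
have gE (C : {set 'I_16}) : even C -> g C =
   g A2 * (#|C| == 2)%:R + g A2 * (#|C| == 14)%:R +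
   g A6 * (#|C| == 6)%:R + g A6 * (#|C| == 10)%:R.
  move=> eC; have C16 : (#|C| <= 16)%N by have := max_card (mem C); rewrite card_ord.
  have eC' : even (~: C) by rewrite /even cC oddB.
  have [|C0] := even_card16 C16 eC.
    rewrite !inE => /or4P[] /eqP kC; rewrite kC /= !mulr0 mulr1 ?addr0 ?add0r.
    - by apply: gC; rewrite // kC.
    - by rewrite -gT //; apply: gC; rewrite // cC kC c2.
    - by apply: gC; rewrite // kC.
    - by rewrite -gT //; apply: gC; rewrite // cC kC c6.
  have -> : g C = 0 by exact: g0.
  have nE k : odd 'C(k.+1, 2) -> (#|C| == k) = false.
    by move=> ek; apply: contraNF C0 => /eqP->.
  by rewrite !nE // !(mulr0, addr0).
have gK (D : {set 'I_16}) : even D -> ~~ odd 'C(#|D|.+1, 2) ->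
    g A2 * (krawtchouk R D 2 + krawtchouk R D 14) +
    g A6 * (krawtchouk R D 6 + krawtchouk R D 10) = 0.
  have krE k : krawtchouk R D k = \sum_(C : {set 'I_16}) bchar R C D * (#|C| == k)%:R.
    rewrite /krawtchouk big_mkcond; apply: eq_bigr => C _.
    by case: eqP; rewrite ?mulr1 ?mulr0.
  move=> eD DD; rewrite -(gB D eD DD) [RHS]big_mkcond !krE -!big_split !mulr_sumr -!big_split /=.
  apply: eq_bigr => C _; case: (boolP (even C)) => [eC|oC].
    by rewrite (gE C eC); ring.
  have nE k : ~~ odd k -> (#|C| == k) = false.
    by move=> ek; apply: contraNF oC => /eqP e; rewrite /even e.
  by rewrite !nE // !(mulr0, addr0).
have eB : even B by rewrite /even cB.
have BB : ~~ odd 'C(#|B|.+1, 2) by rewrite cB.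
have := gK B eB BB; have [-> -> -> ->] := krawtchouk_16_4 R cB => e4.
have e0 := gK set0; rewrite /even cards0 in e0; have {e0} := e0 isT isT.
rewrite !krawtchouk0 => e0.
(* Only the signs of these binomial sums are used, so they are made opaque before [lra]. *)
have p2 : 0 <= 'C(16, 2)%:R + 'C(16, 14)%:R :> R by rewrite addr_ge0 ?ler0n.
have p6 : 0 < 'C(16, 6)%:R + 'C(16, 10)%:R :> R by rewrite addr_gt0 // ltr0n bin_gt0.
move: p2 p6 e0; set x := _%:R + _%:R; set y := _%:R + _%:R => x0 y0 e0.
clearbody x y.
(* This is 48 alpha = 176 beta: alpha and beta then have the same sign, while [e0] is a relation
   with non-negative coefficients. *)
have g26 : 3 * g A2 = 11 * g A6 by lra.
have g6 : g A6 = 0.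
  have : g A6 * (11 * x + 3 * y) = 0.
    transitivity (3 * (g A2 * x + g A6 * y)); last by rewrite e0 mulr0.
    by rewrite [RHS]mulrDr [3 * (_ * x)]mulrA g26; ring.
  move/eqP; rewrite mulf_eq0 => /orP[/eqP-> //|/eqP xy].
  by have xy0 : 0 < 11 * x + 3 * y; [lra | rewrite xy ltxx in xy0].
have g2 : g A2 = 0 by lra.
by move=> A eA; rewrite gE // g2 g6 !mul0r !addr0.
Qed.

(** * Vanishing of an invariant 4-vector *)

Section NoInvariants.
Variables (R : realFieldType) (n : nat) (M : {set 'I_16} -> 'M[R]_n).

Local Notation bcoef := (@blade_coef R 16 (fun=> -1)).
Local Notation even A := (~~ odd #|A|).
Implicit Types A B : {set 'I_16}.

Hypothesis M0 : M set0 = 1%:M.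
Hypothesis MT : M setT = 1%:M.
Hypothesis MM : forall A B, even A -> even B ->
  M A *m M B = bcoef A B *: M (symdiff A B).
Hypothesis M_commutant : forall X,
  (forall A, even A -> X *m M A = M A *m X) -> exists c, X = c%:M.
Variable t : @clifford R n (fun=> 0).
Hypothesis t4 : ext_deg4 t.
Hypothesis t_inv : forall i j, i != j -> ext_endo (1%:M + M [set i; j]) t = 4 *: t.

Local Notation g A := (form_coef M t A A).

Lemma even_setC A : even A -> M (~: A) = bcoef A setT *: M A.
Proof.
move=> eA; have eT : even [set: 'I_16] by rewrite cardsT card_ord.
have -> : ~: A = symdiff A setT by apply/setP=> i; rewrite in_symdiff !inE addbT.
by rewrite -[M A]mulmx1 -MT MM // scalerA bladeN1_coef_sqr scale1r.
Qed.

Lemma form_coef_setCr A B : even B ->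
  form_coef M t A (~: B) = bcoef B setT * form_coef M t A B.
Proof.
by move=> eB; rewrite /form_coef even_setC // -scalemxAr linearZ -scalerAr linearZ.
Qed.

Lemma form_coef_setCl A B : even A ->
  form_coef M t (~: A) B = bcoef A setT * form_coef M t A B.
Proof.
by move=> eA; rewrite /form_coef even_setC // -scalemxAr linearZ -scalerAl linearZ.
Qed.

Lemma form_coef_diag0 A : even A -> g A = 0.
Proof.
apply: (@card_invariant_eq0 R (fun A => g A)).
- move=> {}A B; exact: (form_coef_card M0 MM t_inv).
- move=> {}A eA; rewrite form_coef_setCl // form_coef_setCr // mulrA.
  by rewrite bladeN1_coef_sqr mul1r.
- move=> {}A eA A0; apply: (form_coef_sym M0 MM) => //.
  by rewrite bladeN1_coef_diag -signr_odd (negPf A0).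
- move=> B eB B0; apply: (form_coef_fierz M0 MM M_commutant t) => //.
  by rewrite bladeN1_coef_diag -signr_odd (negPf B0).
Qed.

Lemma no_invariant4 : t = 0.
Proof.
have coef0 A B : even A -> even B -> form_coef M t A B = 0.
  move=> eA eB; have [AB|AB0] := eqVneq (symdiff A B) set0.
    have -> : B = A by rewrite -[RHS]symdiff0 -AB symdiffK.
    exact: form_coef_diag0.
  have [AB|ABT] := eqVneq (symdiff A B) setT; last exact: (form_coef_offdiag M0 MM t_inv).
  have -> : B = ~: A.
    by apply/setP=> i; have /setP/(_ i) := AB; rewrite in_symdiff !inE; do 2 case: (i \in _).
  by rewrite form_coef_setCr // form_coef_diag0 ?mulr0.
apply: ext_pair_ext2_eq0 => // K L.
(* The J M_A span all matrices, so G = 0 makes [t] orthogonal to every product of two bivectors. *)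
have [x ->] := spin_form_span M0 MM M_commutant K.
have [y ->] := spin_form_span M0 MM M_commutant L.
rewrite !linear_sum mulr_suml linear_sum big1 // => A eA.
rewrite mulr_sumr linear_sum big1 // => B eB.
by rewrite !linearZ -scalerAl -scalerAr !linearZ /= [ext_pair _ _]coef0 // !scaler0.
Qed.

End NoInvariants.

(** * Commutant of the half-spin representation *)

(** Sets are given by predicates on [nat] so that cardinalities become [count] over [iota], which
    computes. *)
Definition nset n (p : pred nat) : {set 'I_n} := [set i : 'I_n | p i].

Lemma card_nset n p : #|nset n p| = count p (iota 0 n).
Proof.
rewrite -sum1_card (eq_bigl (fun i : 'I_n => p i)) => [|i]; last by rewrite inE.
by rewrite -(big_mkord p (fun=> 1%N)) sum1_count /index_iota subn0.
Qed.

Lemma nsetI n p q : nset n p :&: nset n q = nset n (predI p q).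
Proof. by apply/setP=> i; rewrite !inE. Qed.

(* Generators of the doubly even self-dual binary code d16+ of length 16. *)
Definition code_gen : seq (pred nat) :=
  (fun i => ~~ odd i) :: [seq (fun i => (k.*2 <= i < k.*2 + 4)%N) | k <- iota 0 7].

Definition code : seq {set 'I_16} := [seq nset 16 p | p <- code_gen].

(** Sizes divisible by 4 make the M_A involutions; even intersections, checked next, make them
    commute. *)
Lemma code_card A : A \in code -> #|A| = 4 \/ #|A| = 8.
Proof.
have /allP H : all (fun A : {set 'I_16} => (#|A| == 4) || (#|A| == 8)) code.
  by rewrite /code all_map /= !card_nset.
by move/H => /orP[]/eqP; [left | right].
Qed.

Lemma code_orthogonal A B : A \in code -> B \in code -> ~~ odd #|A :&: B|.
Proof.
have /allrelP H : allrel (fun A B : {set 'I_16} => ~~ odd #|A :&: B|) code code.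
  by rewrite /code allrel_mapl allrel_mapr /allrel /= !nsetI !card_nset.
exact: H.
Qed.

Fixpoint all_bitseq n (P : bitseq -> bool) : bool :=
  if n is k.+1 then
    all_bitseq k (fun s => P (true :: s)) && all_bitseq k (fun s => P (false :: s))
  else P [::].

Lemma all_bitseqP n P s : all_bitseq n P -> size s = n -> P s.
Proof.
elim: n P s => [|n IH] P [|c s] //= /andP[Pt Pf] [ss].
by case: c; [apply: (IH (fun s => P (true :: s))) | apply: (IH (fun s => P (false :: s)))].
Qed.

(* The combination of the generators whose bits are those of [s]: the first
   coefficient is the common parity of the pairs, the others are prefix sums. *)
Definition code_coef (s : bitseq) : bitseq :=
  nth false s 0 (+) nth false s 1 ::
  [seq foldr addb false [seq nth false s j.*2.+1 | j <- iota 0 k.+1] | k <- iota 0 7].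

Definition code_comb (s : bitseq) i :=
  foldr addb false [seq g.1 && g.2 i | g <- zip (code_coef s) code_gen].

(** Each entry [y] becomes a pair of bits with sum [p]. *)
Definition pairs_of_parity (p : bool) (ys : bitseq) : bitseq :=
  flatten [seq [:: p (+) y; y] | y <- ys].

(** Orthogonality to a window of four says that two consecutive pairs have equal parity. A word is
    thus fixed by one parity and eight bits, reducing the search from 2^16 to 2^9 cases. *)
Lemma code_gen_pairs s : size s = 16 ->
  all (fun p : pred nat => ~~ odd (count (predI p (nth false s)) (iota 0 16))) code_gen ->
  exists2 ys, size ys = 8 & s = pairs_of_parity (nth false s 0 (+) nth false s 1) ys.
Proof.
case: s => [|x0 [|y0 [|x1 [|y1 [|x2 [|y2 [|x3 [|y3 s]]]]]]]] //.
case: s => [|x4 [|y4 [|x5 [|y5 [|x6 [|y6 [|x7 [|y7 [|]]]]]]]]] //= _.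
have window a b c d : ~~ (a (+) (b (+) (c (+) d))) -> c = a (+) b (+) d.
  by move: a b c d; do 4 case.
rewrite !add0n !addn0 !oddD !oddb => /andP[_].
do 7![case/andP=> /window->; rewrite ?addbK] => _.
by exists [:: y0; y1; y2; y3; y4; y5; y6; y7]; rewrite // /pairs_of_parity /= addbK.
Qed.

(** A word orthogonal to the generators is their combination given by [code_coef]; the cases are
    enumerated. *)
Lemma code_self_dual s : size s = 16 ->
  all (fun p : pred nat => ~~ odd (count (predI p (nth false s)) (iota 0 16))) code_gen ->
  all (fun i => nth false s i == code_comb s i) (iota 0 16).
Proof.
move=> ss sP; have [ys ys8 sE] := code_gen_pairs ss sP; move: sP.
move: sE; set p := _ (+) _ => ->.
have : size (p :: ys) = 9 by rewrite /= ys8.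
pose P l := let s := pairs_of_parity (head false l) (behead l) in
  all (fun p : pred nat => ~~ odd (count (predI p (nth false s)) (iota 0 16)))
    code_gen ==> all (fun i => nth false s i == code_comb s i) (iota 0 16).
move=> ys9; apply/implyP; apply: (all_bitseqP (P := P) _ ys9); vm_compute.
by [].
Qed.

(** By self-duality such a [B] is a symmetric difference of generators, and [Q] propagates along
    them. *)
Lemma code_closure (Q : {set 'I_16} -> Prop) B :
  Q set0 -> (forall A C, A \in code -> Q C -> Q (symdiff A C)) ->
  (forall A, A \in code -> ~~ odd #|A :&: B|) -> Q B.
Proof.
move=> Q0 QS oB.
pose s := mkseq (fun k => inord k \in B) 16.
have ss : size s = 16 by rewrite size_mkseq.
have BE : B = nset 16 (nth false s).
  by apply/setP=> i; rewrite inE nth_mkseq // inord_val.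
have /(code_self_dual ss)/allP sE :
    all (fun p : pred nat => ~~ odd (count (predI p (nth false s)) (iota 0 16))) code_gen.
  have : all (fun A => ~~ odd #|A :&: B|) code by apply/allP.
  by rewrite /code all_map BE; apply: sub_all => p; rewrite /= nsetI card_nset.
have {BE}-> : B = nset 16 (code_comb s).
  by rewrite BE; apply/setP=> i; rewrite !inE; apply/eqP/sE; rewrite mem_iota /=.
rewrite /code_comb; move: (code_coef s); rewrite /code in QS.
elim: (code_gen) QS => [|p ps IH] QS l.
  suff -> : nset 16 (fun i => foldr addb false [seq g.1 && g.2 i | g <- zip l [::]]) = set0 by [].
  by apply/setP=> i; rewrite !inE; case: l.
case: l => [|c l].
  by rewrite (_ : nset _ _ = set0) //; apply/setP=> i; rewrite !inE.
have /IH/(_ l) Ql : forall A C, A \in [seq nset 16 p | p <- ps] -> Q C -> Q (symdiff A C).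
  by move=> A C Ap; apply: QS; rewrite inE Ap orbT.
case: c => /=; last exact: Ql.
set C := nset 16 _ in Ql; have := QS (nset 16 p) C (mem_head _ _) Ql.
by congr Q; apply/setP=> i; rewrite in_symdiff !inE.
Qed.

(** * The commutant is reduced to the scalars *)

Section Commutant.
Variables (R : realFieldType) (n : nat) (M : {set 'I_16} -> 'M[R]_n).
Implicit Types (A B C : {set 'I_16}) (u x : 'cV[R]_n).

Local Notation bcoef := (@blade_coef R 16 (fun=> -1)).
Local Notation even A := (~~ odd #|A|).

Hypothesis M0 : M set0 = 1%:M.
Hypothesis MM : forall A B, even A -> even B ->
  M A *m M B = bcoef A B *: M (symdiff A B).
Hypothesis M_cyclic : forall u, u != 0 -> forall x, exists a : {set 'I_16} -> R,
  x = \sum_(A : {set 'I_16} | even A) a A *: (M A *m u).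

Lemma code_even A : A \in code -> even A.
Proof. by case/code_card=> ->. Qed.

Lemma code_sqr A : A \in code -> M A *m M A = 1%:M.
Proof.
move=> cA; rewrite (even_sqr M0 MM) ?code_even // bladeN1_coef_diag.
by case/code_card: cA => ->; rewrite -signr_odd.
Qed.

Lemma code_comm A B : A \in code -> B \in code -> M A *m M B = M B *m M A.
Proof.
move=> cA cB; rewrite (even_comm MM) ?code_even // /bchar -signr_odd.
by rewrite (negPf (code_orthogonal cA cB)) scale1r.
Qed.

(** For one more involution M_A, either v + M_A v is non-zero and has eigenvalue 1, or [v] itself
    has eigenvalue -1; commutation preserves the earlier eigenvalues. *)
Lemma code_eigenvector u : u != 0 -> exists2 v : 'cV[R]_n, v != 0 &
  forall A : {set 'I_16}, A \in code -> exists2 e, e * e = 1 & M A *m v = e *: v.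
Proof.
move=> u0; have: {subset code <= code} by [].
elim: {1 3}code => [|A l IH] sub; first by exists u.
have [v v0 vP] := IH (fun B Bl => sub B (mem_behead (s := A :: l) Bl)).
have cA := sub A (mem_head _ _).
have [e|w0] := eqVneq (v + M A *m v) 0.
  exists v => // B; rewrite inE => /predU1P[->|]; last exact: vP.
  exists (-1); first by rewrite mulrNN mulr1.
  by rewrite scaleN1r; apply/eqP; rewrite -addr_eq0 addrC e.
exists (v + M A *m v) => // B; rewrite inE => /predU1P[->|Bl].
  exists 1; first exact: mulr1.
  by rewrite scale1r mulmxDr mulmxA code_sqr // mul1mx addrC.
have [e e2 eB] := vP B Bl; exists e => //.
have cB : B \in code by apply: sub; rewrite inE Bl orbT.
by rewrite mulmxDr mulmxA (code_comm cB cA) -mulmxA eB -scalemxAr scalerDr.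
Qed.

(** Joint eigenspaces are lines: writing x as a combination of the M_B u, only the [B] orthogonal to
    the code survive; they lie in the code, so M_B acts on [u] by a scalar. *)
Lemma code_eigenspace u x :
  (forall A : {set 'I_16}, A \in code -> exists2 e, e * e = 1 & M A *m u = e *: u /\ M A *m x = e *: x) ->
  u != 0 -> exists a : R, x = a *: u.
Proof.
move=> eP u0; have [a ax] := M_cyclic u0 x.
have {ax} : x = \sum_(B : {set 'I_16} | even B && all (fun A => ~~ odd #|A :&: B|) code)
    a B *: (M B *m u).
  have: {subset code <= code} by [].
  elim: {1 3}code => [|A l IH] sub; first by rewrite ax; apply: eq_bigl => B; rewrite andbT.
  have {IH}xE := IH (fun B Bl => sub B (mem_behead (s := A :: l) Bl)).
  have cA := sub A (mem_head _ _); have [e e2 [eu ex]] := eP A cA.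
  set P := fun B => _ in xE.
  have n2 : 2 != 0 :> R by rewrite pnatr_eq0.
  (* In 2 x = x + e M_A x the terms whose M_B anticommutes with M_A cancel, and the others
     double. *)
  apply: (scalerI n2); transitivity (x + e *: (M A *m x)).
    by rewrite ex scalerA e2 scale1r scaler_nat mulr2n.
  rewrite {2}xE mulmx_sumr scaler_sumr {1}xE -big_split scaler_sumr.
  rewrite big_mkcond [RHS]big_mkcond; apply: eq_bigr => B _; rewrite /P /=.
  case: (boolP (even B)) => //= eB; case: (all _ _); rewrite ?andbF ?andbT //.
  rewrite -scalemxAr mulmxA (even_comm MM (code_even cA) eB) -scalemxAl -mulmxA eu.
  rewrite -!scalemxAr !scalerA /bchar -signr_odd; case: odd; rewrite /= ?expr1 ?expr0.
    by rewrite -scalerDl (_ : _ + _ = 0) ?scale0r //; ring: e2.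
  by rewrite -scalerDl; congr (_ *: _); ring: e2.
move=> xE.
pose Q B := even B /\ exists b : R, M B *m u = b *: u.
have QP B : even B && all (fun A => ~~ odd #|A :&: B|) code -> exists b : R, M B *m u = b *: u.
  move=> /andP[eB /allP oB].
  suff [] : Q B by [].
  apply: (@code_closure Q) => [|A C cA [eC [b bE]]|A cA]; last exact: oB.
    by split; [rewrite cards0 | exists 1; rewrite M0 mul1mx scale1r].
  split; first exact: even_symdiff (code_even cA) eC.
  have [e _ [eu _]] := eP A cA; exists (bcoef A C * (b * e)).
  have -> : M (symdiff A C) = bcoef A C *: (M A *m M C).
    by rewrite (MM (code_even cA) eC) scalerA bladeN1_coef_sqr scale1r.
  by rewrite -scalemxAl -mulmxA bE -scalemxAr eu !scalerA !mulrA.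
rewrite xE; apply: (big_ind (fun y : 'cV[R]_n => exists b : R, y = b *: u)).
- by exists 0; rewrite scale0r.
- by move=> y z [b ->] [c ->]; exists (b + c); rewrite scalerDl.
- by move=> B /QP[b ->]; exists (a B * b); rewrite scalerA.
Qed.

(** [X] preserves the joint eigenline of [v], hence acts on [v] by [c], and so everywhere because
    [v] is cyclic. Over a real field irreducibility alone would only give a division algebra. *)
Lemma commutant_scalar (X : 'M[R]_n) :
  (forall A : {set 'I_16}, even A -> X *m M A = M A *m X) -> exists c, X = c%:M.
Proof.
move=> XM; have [n0|n_gt0] := posnP n.
  by exists 0; apply/matrixP=> i; have := leq_trans (ltn_ord i) (eq_leq n0).
have u0 : const_mx 1 != 0 :> 'cV[R]_n.
  by apply/eqP=> /matrixP/(_ (Ordinal n_gt0) 0); rewrite !mxE => /eqP; rewrite oner_eq0.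
have [v v0 vP] := code_eigenvector u0.
have [c Xv] : exists c : R, X *m v = c *: v.
  apply: code_eigenspace v0 => A cA; have [e e2 ev] := vP A cA; exists e => //.
  by split=> //; rewrite mulmxA -XM ?code_even // -mulmxA ev scalemxAr.
exists c; apply/trmx_inj/row_matrixP => i.
have Xx x : X *m x = c *: x.
  have [a ->] := M_cyclic v0 x; rewrite mulmx_sumr scaler_sumr; apply: eq_bigr => A eA.
  rewrite -scalemxAr mulmxA XM // -mulmxA Xv -scalemxAr !scalerA mulrC.
  by [].
by rewrite -!tr_col !colE Xx mul_scalar_mx.
Qed.

End Commutant.

(** * Derivations and rotations *)

Section ProductOfFour.
Variables (F : fieldType) (A : algType F) (D : {linear A -> A}).
Variables (a b c d : bool -> A).

Lemma prod_sum_bool4 (X := fun i j k l => a i * b j * c k * d l) :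
  (a false + a true) * (b false + b true) * (c false + c true) * (d false + d true) =
    X false false false false +
    X true false false false +
    X false true false false +
    X true true false false +
    X false false true false +
    X true false true false +
    X false true true false +
    X true true true false +
    X false false false true +
    X true false false true +
    X false true false true +
    X true true false true +
    X false false true true +
    X true false true true +
    X false true true true +
    X true true true true.
Proof. by rewrite !mulrDr !mulrDl !addrA. Qed.

(** [D] sends [v false] to [v true] and [v true] to [- v false], as a derivation. *)
Let rotates (v : bool -> A) := forall i y,
  D (v i * y) = (-1) ^+ i *: (v (~~ i) * y) + v i * D y.

Lemma deriv_prod4 (X := fun i j k l => a i * b j * c k * d l) i j k l :
  rotates a -> rotates b -> rotates c -> rotates d -> D 1 = 0 ->
  D (X i j k l) =
    (-1) ^+ i *: X (~~ i) j k l + (-1) ^+ j *: X i (~~ j) k l +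
    (-1) ^+ k *: X i j (~~ k) l + (-1) ^+ l *: X i j k (~~ l).
Proof.
move=> Da Db Dc Dd D1; rewrite /X -(mulr1 (d l)) -!mulrA Da Db Dc Dd D1.
by rewrite mulr0 addr0 !mulr1 !mulrDr -!scalerAr !mulrA !addrA.
Qed.

End ProductOfFour.

(* The coordinates [ev] reduce this identity of [V] to one that [ring] decides. *)
Lemma rotation_poly (F : fieldType) (V : lmodType F) (T : Type) (ev : T -> V -> F)
    (D : V -> V) (X : bool -> bool -> bool -> bool -> V) :
  (forall C x y, ev C (x + y) = ev C x + ev C y) ->
  (forall C (c : F) x, ev C (c *: x) = c * ev C x) ->
  (forall x y, (forall C, ev C x = ev C y) -> x = y) ->
  (forall x y, D (x + y) = D x + D y) -> (forall (c : F) x, D (c *: x) = c *: D x) ->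
  (forall i j k l, D (X i j k l) =
    (-1) ^+ i *: X (~~ i) j k l + (-1) ^+ j *: X i (~~ j) k l +
    (-1) ^+ k *: X i j (~~ k) l + (-1) ^+ l *: X i j k (~~ l)) ->
  let x := X false false false false in
  24 *: (X false false false false +
    X true false false false +
    X false true false false +
    X true true false false +
    X false false true false +
    X true false true false +
    X false true true false +
    X true true true false +
    X false false false true +
    X true false false true +
    X false true false true +
    X true true false true +
    X false false true true +
    X true false true true +
    X false true true true +
    X true true true true) =
  96 *: x + 64 *: D x + 28 *: D (D x) + 4 *: D (D (D x)) + D (D (D (D x))).
Proof.
move=> vD vZ ev_inj DD DZ DX.
have vN C x : ev C (- x) = - ev C x by rewrite -scaleN1r vZ mulN1r.
(* e_k sums the [X] with k arguments [true]; [D] sends it to (k + 1) e_(k+1) - (5 - k) e_(k-1). *)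
pose e1 := X true false false false +
    X false true false false +
    X false false true false +
    X false false false true.
pose e2 := X true true false false +
    X true false true false +
    X false true true false +
    X true false false true +
    X false true false true +
    X false false true true.
pose e3 := X true true true false +
    X true true false true +
    X true false true true +
    X false true true true.
pose e4 := X true true true true.
have D0 : D (X false false false false) = e1.
  by rewrite DX /= expr0 !scale1r.
have D1 : D e1 = 2 *: e2 - 4 *: X false false false false.
  rewrite /e1 !DD !DX /e2 /=; apply: ev_inj => C; rewrite !(vD, vN, vZ); ring.
have D2 : D e2 = 3 *: e3 - 3 *: e1.
  rewrite /e2 !DD !DX /e3 /e1 /=; apply: ev_inj => C; rewrite !(vD, vN, vZ); ring.
have D3 : D e3 = 4 *: e4 - 2 *: e2.
  rewrite /e3 !DD !DX /e4 /e2 /=; apply: ev_inj => C; rewrite !(vD, vN, vZ); ring.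
have DN x : D (- x) = - D x by rewrite -scaleN1r DZ scaleN1r.
rewrite /= D0 D1 !(DD, DN, DZ, D0, D1, D2, D3).
rewrite /e1 /e2 /e3 /e4.
apply: ev_inj => C; rewrite !(vD, vN, vZ); ring.
Qed.

Section Derivation.
Variables (F : numFieldType) (n : nat).

Local Notation E := (@clifford F n (fun=> 0)).
Local Notation gen i := (blade (fun=> 0) [set i] : E).
Implicit Types (x y t : E) (M K : 'M[F]_n).

Lemma ext_line1 i : ext_line 1%:M i = gen i.
Proof.
rewrite /ext_line (bigD1 i) //= big1 => [|k /negPf nk].
  by rewrite mxE eqxx scale1r addr0.
by rewrite mxE nk scale0r.
Qed.

(** The derivation extending [M], as the sum of M(e_k) times the k-th interior product; this form is
    linear at sight and needs no word. *)
Definition ext_deriv M y : E := \sum_k ext_line M k * contract k y.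

Fact ext_deriv_is_linear M : linear (ext_deriv M).
Proof.
move=> a x y; rewrite /ext_deriv scaler_sumr -big_split; apply: eq_bigr => k _.
by rewrite linearP /= mulrDr scalerAr.
Qed.
HB.instance Definition _ M := GRing.isSemilinear.Build F E E _
  (ext_deriv M) (GRing.semilinear_linear (ext_deriv_is_linear M)).

Lemma ext_deriv1 M : ext_deriv M 1 = 0.
Proof. by rewrite /ext_deriv big1 // => k _; rewrite contract1 mulr0. Qed.

(** The sign of the antiderivation [contract k] cancels that of moving M(e_k) past [gen i]. *)
Lemma ext_deriv_genM M i y :
  ext_deriv M (gen i * y) = ext_line M i * y + gen i * ext_deriv M y.
Proof.
rewrite /ext_deriv (eq_bigr (fun k => (k == i)%:R *: (ext_line M k * y) +
  gen i * (ext_line M k * contract k y))) => [|k _].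
  rewrite big_split -mulr_sumr (bigD1 i) //= big1 => [|k /negPf->].
    by rewrite eqxx scale1r addr0.
  by rewrite scale0r.
rewrite contract_genM mulrBr -scalerAr; congr (_ + _).
have ME : ext_line M k * gen i = - (gen i * ext_line M k).
  by rewrite -(ext_line1 i) ext_line_anticomm.
by rewrite !mulrA ME mulNr opprK.
Qed.
Lemma ext_deriv_lineM M K j y :
  ext_deriv M (ext_line K j * y) =
  ext_line (M *m K) j * y + ext_line K j * ext_deriv M y.
Proof.
rewrite {1}/ext_line mulr_suml linear_sum.
rewrite (eq_bigr (fun k => K k j *: ext_line M k * y + K k j *: gen k * ext_deriv M y)); last first.
  by move=> k _; rewrite -!scalerAl linearZ /= ext_deriv_genM scalerDr.
rewrite big_split -!mulr_suml; congr (_ * _ + _).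
rewrite (eq_bigr (fun k => \sum_i (M i k * K k j) *: gen i)) => [|k _].
  by rewrite exchange_big; apply: eq_bigr => i _; rewrite mxE scaler_suml.
by rewrite /ext_line scaler_sumr; apply: eq_bigr => i _; rewrite scalerA mulrC.
Qed.

Lemma ext_line_sum M K j : ext_line (M + K) j = ext_line M j + ext_line K j.
Proof.
by rewrite /ext_line -big_split; apply: eq_bigr => i _; rewrite mxE scalerDl.
Qed.

Lemma ext_lineN M j : ext_line (- M) j = - ext_line M j.
Proof.
by rewrite /ext_line -sumrN; apply: eq_bigr => i _; rewrite mxE scaleNr.
Qed.

(* If [M] squares to [-1], then [1 + M] is [sqrt 2] times the exponential of
   [pi / 4 *: M], so its action on a product of four vectors is a polynomial in
   the derivation extending [M]. *)
Lemma ext_endo_deriv M t : M *m M = - 1%:M -> ext_deg4 t ->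
  24 *: ext_endo (1%:M + M) t =
  96 *: t + 64 *: ext_deriv M t + 28 *: ext_deriv M (ext_deriv M t) +
  4 *: ext_deriv M (ext_deriv M (ext_deriv M t)) +
  ext_deriv M (ext_deriv M (ext_deriv M (ext_deriv M t))).
Proof.
move=> M2 t4; pose D := ext_deriv M.
(* Divided by 24, the polynomial interpolates 4 exp(pi D / 4) at the possible eigenvalues 0, ±2i,
   ±4i of [D] in degree 4. *)
apply: (@ext_deg4_ind _ _ _ ((24 : F) \*: ext_endo (1%:M + M))
  ((((((96 : F) \*: idfun) \+ ((64 : F) \*: D)) \+ ((28 : F) \*: (D \o D))) \+
    ((4 : F) \*: (D \o D \o D))) \+ (D \o D \o D \o D)) t t4) => i j k l /=.
rewrite !ext_endoM !ext_endo_gen !ext_line_sum -!ext_line1.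
pose a b i := ext_line (if b then M else 1%:M) i.
pose X b1 b2 b3 b4 := a b1 i * a b2 j * a b3 k * a b4 l.
have D1 z b y : D (a b z * y) = (-1) ^+ b *: (a (~~ b) z * y) + a b z * D y.
  rewrite /D /a ext_deriv_lineM; case: b; rewrite /= ?mulmx1 ?scale1r //.
  by rewrite M2 ext_lineN expr1 scaleN1r mulNr.
have DX b1 b2 b3 b4 : D (X b1 b2 b3 b4) =
    (-1) ^+ b1 *: X (~~ b1) b2 b3 b4 + (-1) ^+ b2 *: X b1 (~~ b2) b3 b4 +
    (-1) ^+ b3 *: X b1 b2 (~~ b3) b4 + (-1) ^+ b4 *: X b1 b2 b3 (~~ b4).
  exact: (deriv_prod4 _ _ _ _ (D1 i) (D1 j) (D1 k) (D1 l) (ext_deriv1 M)).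
have DD x y : D (x + y) = D x + D y by rewrite /D linearD.
have DZ (c : F) x : D (c *: x) = c *: D x by rewrite /D linearZ.
have XS := prod_sum_bool4 (a^~ i) (a^~ j) (a^~ k) (a^~ l).
have vD C x y : (x + y) C = x C + y C :> F by rewrite ffunE.
have vZ C (c : F) x : (c *: x) C = c * x C :> F by rewrite ffunE.
have v_inj x y : (forall C, x C = y C :> F) -> x = y by move=> xy; apply/ffunP.
by rewrite -(rotation_poly (ev := fun C x => x C) vD vZ v_inj DD DZ DX) -XS.
Qed.

End Derivation.

(** * The half-spin representation of Spin(16) *)

Section EndMatrix.
Variables (F : numFieldType) (V : vectType F).
Local Notation n := (\dim {:V}).
Implicit Types (f g : 'End(V)) (v : V).

Definition coords v : 'cV[F]_n := \col_i coord (vbasis {:V}) i v.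
Definition end_mx f : 'M[F]_n := \matrix_(i, j) coord (vbasis {:V}) i (f (ext_basis j)).

Fact coords_is_linear : linear coords.
Proof. by move=> a u v; apply/colP=> i; rewrite !mxE linearP. Qed.
HB.instance Definition _ := GRing.isSemilinear.Build F V 'cV[F]_n _ coords
  (GRing.semilinear_linear coords_is_linear).

Lemma coords_surj (u : 'cV[F]_n) : exists v, coords v = u.
Proof.
exists (\sum_i u i 0 *: ext_basis i); apply/colP=> i; rewrite mxE linear_sum.
rewrite (bigD1 i) //= big1 => [|j nj].
  by rewrite linearZ /= coord_free ?eqxx ?mulr1 ?addr0 // (basis_free (vbasisP _)).
by rewrite linearZ /= coord_free ?(basis_free (vbasisP _)) // (negPf nj) mulr0.
Qed.

Lemma coords_end f v : coords (f v) = end_mx f *m coords v.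
Proof.
apply/colP=> i; rewrite !mxE {1}(coord_vbasis (memvf v)) !linear_sum.
by apply: eq_bigr => j _; rewrite !linearZ /= !mxE mulrC.
Qed.

Lemma end_mx_eq f (K : 'M[F]_n) : (forall v, coords (f v) = K *m coords v) -> end_mx f = K.
Proof.
move=> fK; apply/matrixP=> i j; have := fK (ext_basis j).
rewrite coords_end => /colP/(_ i).
have -> : coords (ext_basis j) = delta_mx j 0.
  by apply/colP=> k; rewrite !mxE andbT coord_free ?(basis_free (vbasisP _)) // eq_sym.
by rewrite -!colE !mxE.
Qed.

Lemma ext_mapE f x : ext_map f x = ext_endo (end_mx f) x.
Proof.
apply: eq_bigr => A _; congr (_ *: _); apply: eq_bigr => i _.
by apply: eq_bigr => j _; rewrite mxE.
Qed.

Lemma ext_power4 t : t \in ext_power V 4 -> ext_deg4 (t : clifford (fun=> 0)).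
Proof.
case/memv_sumP=> a aP -> B cB; rewrite sum_ffunE big1 // => A cA.
have /vlineP[k ->] := aP A cA; rewrite !ffunE.
by case: eqP => [e|_]; [rewrite e cA in cB | rewrite scaler0].
Qed.

Lemma ext_derE f x : ext_der f x = ext_deriv (end_mx f) x.
Proof.
have lineE i : ext_vec (f (ext_basis i)) = ext_line (end_mx f) i.
  by apply: eq_bigr => j _; rewrite mxE.
(* Positions are named by their letters, which must therefore be distinct. *)
have derE (s : seq 'I_n) : uniq s ->
    \sum_(j <- s) \prod_(i <- s)
      ext_vec (if i == j then f (ext_basis i) else ext_basis i) =
    ext_deriv (end_mx f) (\prod_(i <- s) blade _ [set i]).
  elim: s => [_|a s IH /= /andP[nas us]]; first by rewrite !big_nil ext_deriv1.
  rewrite [RHS](congr1 _ (big_cons _ _ _ _ _ _)) ext_deriv_genM -IH //.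
  rewrite big_cons big_cons eqxx lineE; congr (_ * _ + _).
    apply: eq_big_seq => i si; case: eqP => [e|_]; first by rewrite -e si in nas.
    by rewrite ext_vec_basis.
  rewrite mulr_sumr; apply: eq_big_seq => j sj; rewrite big_cons.
  case: eqP => [e|_]; first by rewrite e sj in nas.
  by rewrite ext_vec_basis.
rewrite [in RHS](cl_basis x) linear_sum; apply: eq_bigr => A _.
rewrite linearZ /= blade_prod; congr (_ *: _).
by rewrite -derE ?enum_uniq //  big_enum.
Qed.

End EndMatrix.

(** * Even blades and quarter turns on the half-spin module *)

Section HalfSpin16.
Variables (R : realType) (N : nat) (rho : {lrmorphism Cl R 16 -> 'M[R]_N.+1}).
Hypothesis irr_rho : irreducible_module rho.

Local Notation S := (subvs_of (half_spin rho)).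
Local Notation rep := (half_spin_rep rho).
Local Notation e A := (blade (fun=> -1) A : Cl R 16).
Local Notation bcoef := (@blade_coef R 16 (fun=> -1)).
Local Notation even A := (~~ odd #|A|).
Implicit Types (A B : {set 'I_16}) (u : S).

Lemma rhoM (x y : Cl R 16) : rho (x * y) = rho x *m rho y.
Proof. exact: rmorphM. Qed.

Lemma rhoZ (k : R) (x : Cl R 16) : rho (k *: x) = k *: rho x.
Proof. exact: linearZ. Qed.

Lemma volumeE : volume R 16 = e setT.
Proof. by rewrite [RHS]blade_prod enum_setT /volume /index_enum -enumT. Qed.

Lemma blade_volume A : e A * volume R 16 = (-1) ^+ #|A| *: (volume R 16 * e A).
Proof.
rewrite volumeE !blade_mul bladeN1_coefC symdiffC scalerA; congr (_ * _ *: _).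
by rewrite setIT cardsT card_ord -signr_odd oddD oddM andbF signr_odd.
Qed.

Lemma even_volume A : even A -> e A * volume R 16 = volume R 16 * e A.
Proof. by move=> eA; rewrite blade_volume -signr_odd (negPf eA) scale1r. Qed.

Lemma rep_even A u : even A -> vsval (rep (e A) u) = rho (e A) *m vsval u.
Proof. by move=> eA; rewrite half_spin_repE // even_volume. Qed.

Lemma rho_volume u : rho (volume R 16) *m vsval u = vsval u.
Proof. by have /fixedSpaceP := subvsP u; rewrite lfunE. Qed.

Lemma val_scale (k : R) u : vsval (k *: u) = k *: vsval u.
Proof. by []. Qed.

Lemma rep_mul A B u : even A -> even B ->
  rep (e A) (rep (e B) u) = bcoef A B *: rep (e (symdiff A B)) u.
Proof.
move=> eA eB; apply: subvs_inj; rewrite val_scale !rep_even ?even_symdiff //.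
by rewrite mulmxA -rhoM blade_mul rhoZ scalemxAl.
Qed.

Lemma rep0 u : rep (e set0) u = u.
Proof.
apply: subvs_inj; rewrite rep_even ?cards0 //.
by rewrite -[e set0]/(1 : Cl R 16) rmorph1 mul1mx.
Qed.

Lemma repT u : rep (e setT) u = u.
Proof.
by apply: subvs_inj; rewrite rep_even ?cardsT ?card_ord // -volumeE rho_volume.
Qed.

Lemma rep_cyclic u : u != 0 -> forall v : S, exists a : {set 'I_16} -> R,
  v = \sum_(A : {set 'I_16} | even A) a A *: rep (e A) u.
Proof.
move=> u0 v; pose act (a : Cl R 16) : 'cV[R]_N.+1 := rho a *m vsval u.
have act_lin : linear act by move=> k a b; rewrite /act linearP /= mulmxDl scalemxAl.
pose actL : {linear Cl R 16 -> 'cV[R]_N.+1} :=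
  HB.pack act (GRing.isSemilinear.Build R (Cl R 16) 'cV[R]_N.+1 _ act
    (GRing.semilinear_linear act_lin)).
have actE a : linfun actL a = act a := lfunE actL a.
have full : limg (linfun actL) = fullv.
  have [x w|U0|//] := irr_rho (U := limg (linfun actL)).
    case/memv_imgP=> a _ ->; rewrite actE /act mulmxA.
    rewrite -rhoM; apply/memv_imgP; exists (x * a); [exact: memvf|exact/esym/actE].
  have : vsval u \in limg (linfun actL).
    by apply/memv_imgP; exists 1; rewrite ?memvf // actE /act rmorph1 mul1mx.
  by rewrite U0 memv0 => u00; case/negP: u0; apply/eqP/subvs_inj/eqP.
have /memv_imgP[a _ va] : vsval v \in limg (linfun actL) by rewrite full memvf.
rewrite actE /act in va; exists (fun A => a A).
have aE : vsval v = \sum_A (a A : R) *: (rho (e A) *m vsval u).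
  rewrite va {1}(cl_basis a) linear_sum mulmx_suml; apply: eq_bigr => A _.
  by rewrite /= rhoZ scalemxAl.
(* The volume element fixes [u] and [v] and anticommutes with odd blades; adding this expansion to
   [aE] removes the odd terms. *)
have aE' : vsval v = \sum_(A : {set 'I_16}) (-1) ^+ #|A| *: ((a A : R) *: (rho (e A) *m vsval u)).
  rewrite -rho_volume aE mulmx_sumr; apply: eq_bigr => A _.
  rewrite -scalemxAr scalerA mulrC -scalerA; congr (_ *: _).
  rewrite -{2}(rho_volume u) !mulmxA -!rhoM blade_volume rhoZ -scalemxAl scalerA.
  by rewrite -expr2 sqrr_sign scale1r.
apply: subvs_inj; have n2 : 2 != 0 :> R by rewrite pnatr_eq0.
apply: (scalerI n2); rewrite linear_sum scaler_sumr scaler_nat mulr2n {1}aE aE' -big_split.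
rewrite [RHS]big_mkcond; apply: eq_bigr => A _ /=; rewrite -signr_odd.
case: (boolP (odd #|A|)) => [_|eA]; first by rewrite expr1 scaleN1r subrr.
by rewrite expr0 scale1r -mulr2n -scaler_nat; congr (_ *: _); rewrite -(rep_even u eA).
Qed.

Definition spin_mx A : 'M[R]_(\dim {:S}) := end_mx (rep (e A)).

Lemma spin_mxE A u : spin_mx A *m coords u = coords (rep (e A) u).
Proof. by rewrite coords_end. Qed.

Lemma spin_mx0 : spin_mx set0 = 1%:M.
Proof. by apply: end_mx_eq => u; rewrite rep0 mul1mx. Qed.

Lemma spin_mxT : spin_mx setT = 1%:M.
Proof. by apply: end_mx_eq => u; rewrite repT mul1mx. Qed.

Lemma mx_coordsP (K L : 'M[R]_(\dim {:S})) :
  (forall u, K *m coords u = L *m coords u) -> K = L.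
Proof.
move=> KL; apply/trmx_inj/row_matrixP => i.
by have [u uE] := coords_surj (delta_mx i 0); rewrite -!tr_col !colE -uE KL.
Qed.

Lemma spin_mxM A B : even A -> even B ->
  spin_mx A *m spin_mx B = bcoef A B *: spin_mx (symdiff A B).
Proof.
move=> eA eB; apply: mx_coordsP => u.
by rewrite -mulmxA !spin_mxE rep_mul // -scalemxAl spin_mxE linearZ.
Qed.

Lemma spin_mx_cyclic (x : 'cV[R]_(\dim {:S})) : x != 0 ->
  forall y, exists a : {set 'I_16} -> R,
    y = \sum_(A : {set 'I_16} | even A) a A *: (spin_mx A *m x).
Proof.
have [u <-] := coords_surj x => u0 y; have [v <-] := coords_surj y.
have [|a ->] := rep_cyclic _ v (u := u).
  by apply: contra_neq u0 => ->; rewrite linear0.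
exists a; rewrite linear_sum; apply: eq_bigr => A _.
by rewrite linearZ /= spin_mxE.
Qed.

Lemma half_spin_no_invariant (t : clifford (fun=> 0)) : ext_deg4 t ->
  (forall i j : 'I_16, (i < j)%N -> ext_endo (1%:M + spin_mx [set i; j]) t = 4 *: t) ->
  t = 0.
Proof.
move=> t4 tP; apply: (no_invariant4 spin_mx0 spin_mxT spin_mxM) => //.
  exact: (commutant_scalar spin_mx0 spin_mxM spin_mx_cyclic).
move=> i j nij; have [lij|lji|/val_inj e] := ltngtP i j.
- exact: tP.
- by rewrite setUC; apply: tP.
- by rewrite e eqxx in nij.
Qed.

Lemma blade_set2 (i j : 'I_16) : (i < j)%N -> e [set i] * e [set j] = e [set i; j].
Proof.
move=> lij; rewrite blade_mul /blade_coef /blade_sign !big_set1 ltnNge ltnW //= mul1r.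
have nij : i != j by apply: contraTneq lij => ->; rewrite ltnn.
rewrite big1 ?scale1r => [|k]; last first.
  by rewrite !inE => /andP[/eqP->]; rewrite (negPf nij).
congr blade; apply/setP=> k; rewrite in_symdiff !inE.
by case: (k =P i) => [->|_]; rewrite ?(negPf nij).
Qed.

(** With D t = 0 only the term 96 t of [ext_endo_deriv] remains, and 96 / 24 = 4. *)
Lemma rotation_of_derivation (i j : 'I_16) (t : clifford (fun=> 0)) : (i < j)%N -> ext_deg4 t ->
  ext_deriv (spin_mx [set i; j]) t = 0 ->
  ext_endo (1%:M + spin_mx [set i; j]) t = 4 *: t.
Proof.
move=> lij t4 Dt; have nij : i != j by apply: contraTneq lij => ->; rewrite ltnn.
have D2 : spin_mx [set i; j] *m spin_mx [set i; j] = - 1%:M.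
  by rewrite spin_mxM ?cards2 ?nij // bladeN1_coef_set2 // symdiffxx spin_mx0 scaleN1r.
have n24 : 24 != 0 :> R by rewrite pnatr_eq0.
apply: (scalerI n24); rewrite (ext_endo_deriv D2 t4) Dt !linear0 ?scaler0 !addr0.
by rewrite scalerA -natrM.
Qed.

(** exp(pi/4 e_i e_j), a lift of the rotation by a right angle in the plane of [i] and [j]. *)
Definition quarter_turn (i j : 'I_16) : Cl R 16 :=
  Num.sqrt 2^-1 *: (1 + e [set i] * e [set j]).

Lemma quarter_turn_Spin (i j : 'I_16) : (i < j)%N -> Spin (quarter_turn i j).
Proof.
move=> lij; have nij : i != j by apply: contraTneq lij => ->; rewrite ltnn.
set a := Num.sqrt (2^-1 : R).
have a2 : a ^+ 2 = 2^-1 by rewrite sqr_sqrtr // invr_ge0 ler0n.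
(* Since e_i squares to -1, e_i (e_j - e_i) = 1 + e_i e_j. *)
exists [:: delta_mx 0 i; a *: (delta_mx 0 j - delta_mx 0 i)]; split=> //.
  move=> v; rewrite !inE => /orP[]/eqP->; rewrite /unit_vector.
    rewrite (bigD1 i) //= big1 ?mxE ?eqxx ?expr1n ?addr0 // => k nk.
    by rewrite mxE (negPf nk) andbF expr0n.
  rewrite (bigD1 i) //= (bigD1 j) ?(eq_sym j) //= big1 => [|k /andP[nki nkj]].
    rewrite !mxE !eqxx (eq_sym j) (negPf nij) /= sub0r subr0 mulrN1 mulr1 sqrrN addr0 a2.
    by rewrite -mulr2n -[_ *+ 2]mulr_natr mulVf // pnatr_eq0.
  by rewrite !mxE (negPf nki) (negPf nkj) andbF subrr mulr0 expr0n.
rewrite !big_cons big_nil mulr1 cl_vec_delta.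
have -> : cl_vec (fun=> -1) (a *: (delta_mx 0 j - delta_mx 0 i)) = a *: (e [set j] - e [set i]).
  rewrite -!cl_vec_delta /cl_vec -sumrB scaler_sumr; apply: eq_bigr => k _.
  by rewrite -scalerBl scalerA !mxE.
rewrite -scalerAr mulrBr gen_sqr /quarter_turn scaleN1r opprK addrC.
by [].
Qed.

Lemma quarter_turn_mx (i j : 'I_16) : (i < j)%N ->
  end_mx (rep (quarter_turn i j)) = Num.sqrt 2^-1 *: (1%:M + spin_mx [set i; j]).
Proof.
move=> lij; have nij : i != j by apply: contraTneq lij => ->; rewrite ltnn.
have eD : even [set i; j] by rewrite cards2 nij.
apply: end_mx_eq => u; rewrite -scalemxAl mulmxDl mul1mx spin_mxE -linearD -linearZ.
congr coords; apply: subvs_inj.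
have hE : quarter_turn i j = Num.sqrt 2^-1 *: (1 + e [set i; j]) by rewrite -blade_set2.
rewrite half_spin_repE; last first.
  by rewrite hE -scalerAl -scalerAr mulrDl mulrDr mul1r mulr1 even_volume.
rewrite val_scale hE rhoZ -scalemxAl; congr (_ *: _).
by rewrite linearD /= rmorph1 mulmxDl mul1mx -rep_even.
Qed.

(** In degree 4 the normalisation 1 / sqrt 2 contributes 1/4. *)
Lemma rotation_of_quarter_turn (i j : 'I_16) (t : clifford (fun=> 0)) : (i < j)%N ->
  ext_deg4 t -> ext_endo (end_mx (rep (quarter_turn i j))) t = t ->
  ext_endo (1%:M + spin_mx [set i; j]) t = 4 *: t.
Proof.
move=> lij t4; rewrite quarter_turn_mx // ext_endoZ4 // => tE.
have a4 : Num.sqrt 2^-1 ^+ 4 = 4^-1 :> R.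
  rewrite (exprM _ 2 2) sqr_sqrtr ?invr_ge0 ?ler0n // exprVn; congr (_^-1).
  by rewrite -natrX.
by rewrite -{2}tE a4 scalerA divff ?scale1r // pnatr_eq0.
Qed.

End HalfSpin16.

Theorem proposition4p1 (R : realType) (N : nat)
    (rho : {lrmorphism Cl R 16 -> 'M[R]_N.+1})
    (irr_rho : irreducible_module rho) :
  ~ trivial_summand (@Spin R 16) (fun g => ext_map (half_spin_rep rho g))
      (ext_power (subvs_of (half_spin rho)) 4)
  /\
  (forall t : ext_alg (subvs_of (half_spin rho)),
     t \in ext_power (subvs_of (half_spin rho)) 4 ->
     (forall X : Cl R 16, X \in spin_lie R 16 ->
        ext_der (half_spin_rep rho X) t = 0) ->
     t = 0).
Proof.
split.
  case=> T [W [T0 TW _ Tinv _]].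
  (* Any non-zero vector of a trivial summand is an invariant 4-vector. *)
  have tT : vpick T \in T := memv_pick T.
  have /ext_power4 t4 : vpick T \in ext_power (subvs_of (half_spin rho)) 4.
    by rewrite -TW; apply: (subvP (addvSl T W)).
  move: T0; rewrite -vpick0 => /eqP; apply.
  apply: (half_spin_no_invariant irr_rho t4) => i j lij.
  apply: rotation_of_quarter_turn => //.
  by have := Tinv _ _ (quarter_turn_Spin R lij) tT; rewrite ext_mapE.
move=> t /ext_power4 t4 tX.
apply: (half_spin_no_invariant irr_rho t4) => i j lij.
(* Each e_i e_j with i < j is one of the spanning elements of [spin_lie]. *)
apply: rotation_of_derivation => //; rewrite -ext_derE -blade_set2 //.
apply: tX; apply: (subvP (sumv_sup i _ (sumv_sup j lij (subvv _)))) => //.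
exact: memv_line.
Qed.
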